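(* Let $B$ be a Bratteli diagram with $2 \times 2$ incidence matrices $F_n$ ($n\ge1$) satisfying the equal row sum property: $$F_n = \begin{pmatrix} a_n & c_n\\ d_n & b_n \end{pmatrix}, \qquad a_n + c_n = d_n + b_n = r_n \ \text{ for every } n.$$ Then the following hold. (1) There are exactly two finite ergodic invariant measures on $B$ if and only if $$\sum_{k=1}^{\infty}\left(1 - \frac{|a_{k} - d_{k}|}{r_k}\right) < \infty,$$ or, equivalently, $$\sum_{k=1}^{\infty}\left(1 - \frac{\max\{a_{k},d_{k}\}}{r_k}\right) < \infty \quad\text{and}\quad \sum_{k=1}^{\infty} \frac{\min\{a_{k},d_{k}\}}{r_k} < \infty.$$ In this case, there are subdiagrams of $B$ that are odometers and support these measures, i.e. each of the two measures is the extension of a measure from an odometer. (2) There is a unique invariant measure $\mu$ on $B$ if and only if $$\sum_{k=1}^{\infty}\left(1 - \frac{|a_{k} - d_{k}|}{r_k}\right) = \infty. \qquad (\ast)$$ Moreover, if $$\sum_{k=1}^{\infty} \min\left\{\frac{\min\{a_{k},d_{k}\}}{r_k},\ 1 - \frac{\max\{a_{k},d_{k}\}}{r_k} \right\}= \infty, \qquad (\ast\ast)$$ then there is no odometer such that the unique measure $\mu$ is the extension of a measure supported by this odometer. If $(\ast)$ holds and $(\ast\ast)$ does not hold, both possibilities occur: there is an example of such a diagram $B$ for which the unique invariant measure is an extension from an odometer, and there is an example of such a diagram for which it is not an extension from any odometer.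
   Context: A Bratteli diagram $B=(V,E)$ is an infinite graph with $V=\bigcup_{i\ge 0}V_i$, $E=\bigcup_{i\ge1}E_i$ (disjoint finite levels, $V_0=\{v_0\}$), with range and source maps $r,s$ on edges such that $r(E_i)=V_i$, $s(E_i)=V_{i-1}$, $s^{-1}(v)\ne\emptyset$ for all $v$, and $r^{-1}(v)\neq\emptyset$ for all $v\ne v_0$. The $n$-th incidence matrix is $F_n=(f^{(n)}_{v,w})_{v\in V_{n+1},w\in V_n}$, where $f^{(n)}_{v,w}$ is the number of edges from $w$ to $v$. Here $|V_n|=2$ for $n\ge1$, and the equal row sum property includes $F_0=(r_0,r_0)^T$ for some $r_0\in\mathbb N$. $X_B$ is the space of infinite paths starting at $v_0$ with the cylinder topology, assumed to be a Cantor set. Two paths are tail equivalent, $(x,y)\in\mathcal E$, if they agree from some index on. A Borel measure on $X_B$ is invariant ($\mathcal E$-invariant) if any two cylinder sets given by finite paths from $v_0$ to the same vertex have equal measure. ''Invariant measure on $B$'' means an $\mathcal E$-invariant probability Borel measure on $X_B$; finite measures are counted up to multiplication by positive constants. An odometer in $B$ is a vertex subdiagram $\overline B$ with exactly one vertex at each level: it is given by vertices $w_n\in V_n$ ($n\ge1$) with $f^{(n)}_{w_{n+1},w_n}>0$, and consists of these vertices, $v_0$, and all edges of $B$ between consecutive ones. Its path space $X_{\overline B}\subset X_B$ carries a unique tail-invariant probability measure $\overline\mu$. Let $\widehat X_{\overline B}$ be the set of all paths in $X_B$ tail equivalent to a path of $X_{\overline B}$. The extension $\widehat{\overline\mu}$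 of $\overline\mu$ is the unique $\mathcal E$-invariant Borel measure (finite or infinite) on $\widehat X_{\overline B}$ restricting to $\overline\mu$ on $X_{\overline B}$, extended by $0$ to $X_B\setminus\widehat X_{\overline B}$. A probability measure $\mu$ on $X_B$ ''is the extension of a measure from (supported by) the odometer $\overline B$'' if $\mu$ is a positive constant multiple of $\widehat{\overline\mu}$ (in particular $\widehat{\overline\mu}$ is finite). *)

(* Defs.v *)
From HB Require Import structures.
From mathcomp Require Import all_boot all_order all_algebra.
From mathcomp Require Import all_classical all_reals all_analysis.

Set Implicit Arguments.
Unset Strict Implicit.
Unset Printing Implicit Defensive.

Import Order.TTheory GRing.Theory Num.Theory.

Local Open Scope classical_set_scope.

(* [edge n] is E_{n+1}, the set of edges from V_n to V_{n+1}; disjointness of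
   the levels is built into the typing. *)
Record bratteli := Bratteli {
  vertex : nat -> finType;
  edge : nat -> finType;
  esrc : forall n, edge n -> vertex n;
  erng : forall n, edge n -> vertex n.+1;
  card_vertex0 : #|vertex 0| = 1%N;
  esrc_surj : forall n (v : vertex n), exists e : edge n, esrc e = v;
  erng_surj : forall n (v : vertex n.+1), exists e : edge n, erng e = v
}.

(* f^{(n)}_{v,w}, the (v,w) entry of F_n *)
Definition incidence (B : bratteli) (n : nat) (v : vertex B n.+1)
    (w : vertex B n) : nat :=
  #|[pred e : edge B n | (esrc e == w) && (erng e == v)]|.

(* The cylinder topology is the topology induced by the product of the
   discrete topologies on the edge sets. *)
Definition path_set (B : bratteli) :
    set (prod_topology (fun n => discrete_topology (edge B n))) :=
  [set x | forall n, @erng B n (x n) = @esrc B n.+1 (x n.+1)].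
Arguments path_set : clear implicits.

Definition path_space (B : bratteli) : Type := set_type (path_set B).

HB.instance Definition _ (B : bratteli) := Topological.on (path_space B).

Definition pedge (B : bratteli) (x : path_space B) (n : nat) : edge B n :=
  set_val x n.

Definition pvertex (B : bratteli) (x : path_space B) (n : nat) : vertex B n :=
  esrc (pedge x n).

Lemma path_inhabited (B : bratteli) : exists x : path_space B, True.
Proof.
have v0 : vertex B 0.
  by have /card_gt0P/sigW[] : 0 < #|vertex B 0| by rewrite card_vertex0.
pose nxt n (v : vertex B n) := projT1 (cid (esrc_surj v)).
have nxtP n (v : vertex B n) : esrc (nxt n v) = v.
  by rewrite /nxt; case: cid.
pose fix vs n : vertex B n :=
  if n is m.+1 then erng (nxt m (vs m)) else v0.
have xP : path_set B (fun n => nxt n (vs n)) by move=> n; rewrite nxtP.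
by exists (SigSub (mem_set xP) : path_space B).
Qed.

HB.instance Definition _ (B : bratteli) :=
  isPointed.Build (path_space B) (projT1 (cid (path_inhabited B))).

Definition is_cantor_set (T : topologicalType) : Prop :=
  exists (f : T -> cantor_space) (g : cantor_space -> T),
    [/\ continuous f, continuous g, cancel f g & cancel g f].

Definition borel_path (B : bratteli) :=
  g_sigma_algebraType (@open (path_space B)).

(* A finite path of length n from v_0 is the prefix of some infinite path, so
   cylinder sets are indexed by pairs (x, n); the end vertex of the prefix is
   [pvertex x n]. *)
Definition cylinder (B : bratteli) (x : path_space B) (n : nat) : set (path_space B) :=
  [set y | forall i, (i < n)%N -> pedge y i = pedge x i].

Definition agree_from (B : bratteli) (n : nat) (x y : path_space B) : Prop :=
  forall i, (n <= i)%N -> pedge x i = pedge y i.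

Definition tail_equiv (B : bratteli) (x y : path_space B) : Prop :=
  exists n, agree_from n x y.

Definition same_measure (B : bratteli) (R : realType)
    (mu nu : set (borel_path B) -> \bar R) : Prop :=
  forall A : set (borel_path B), measurable A -> mu A = nu A.

Definition invariant (B : bratteli) (R : realType)
    (mu : set (borel_path B) -> \bar R) : Prop :=
  forall (x y : path_space B) (n : nat), pvertex x n = pvertex y n ->
    mu (cylinder x n) = mu (cylinder y n).

(* For a set A of paths beginning with a prefix that ends at [pvertex y n],
   replace that prefix by the prefix of length n of y. *)
Definition switch_prefix (B : bratteli) (y : path_space B) (n : nat)
    (A : set (path_space B)) : set (path_space B) :=
  [set z | cylinder y n z /\ exists2 z', A z' & agree_from n z z'].

(* E-invariance of a possibly infinite measure.  For finite measures it is
   equivalent to [invariant]; a measure that is infinite on cylinder sets is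
   not controlled by its values on them, so all Borel subsets are compared. *)
Definition holonomy_invariant (B : bratteli) (R : realType)
    (m : set (borel_path B) -> \bar R) : Prop :=
  forall (x y : path_space B) (n : nat) (A : set (borel_path B)),
    pvertex x n = pvertex y n -> measurable A -> A `<=` cylinder x n ->
    m A = m (switch_prefix y n A).

Definition ergodic (B : bratteli) (R : realType)
    (mu : set (borel_path B) -> \bar R) : Prop :=
  forall A : set (borel_path B), measurable A ->
    (forall x y : path_space B, tail_equiv x y -> A x -> A y) ->
    mu A = 0%E \/ mu (~` A) = 0%E.

Definition ergodic_invariant (B : bratteli) (R : realType)
    (mu : probability (borel_path B) R) : Prop :=
  invariant mu /\ ergodic mu.

(* Measures up to positive multiples are represented by probabilities. *)
Definition exactly_two_ergodic (B : bratteli) (R : realType) : Prop :=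
  exists mu nu : probability (borel_path B) R,
    [/\ ergodic_invariant mu, ergodic_invariant nu, ~ same_measure mu nu
      & forall rho : probability (borel_path B) R, ergodic_invariant rho ->
          same_measure rho mu \/ same_measure rho nu].

Definition unique_invariant (B : bratteli) (R : realType)
    (mu : probability (borel_path B) R) : Prop :=
  invariant mu /\
  forall nu : probability (borel_path B) R, invariant nu -> same_measure nu mu.

(* w 0 is necessarily v_0, and positivity for n = 0 is automatic. *)
Definition odometer (B : bratteli) (w : forall n, vertex B n) : Prop :=
  forall n, (0 < incidence (w n.+1) (w n))%N.

Definition odometer_paths (B : bratteli) (w : forall n, vertex B n) :
    set (path_space B) :=
  [set x | forall n, pvertex x n = w n].

Definition odometer_saturation (B : bratteli) (w : forall n, vertex B n) :
    set (path_space B) :=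
  [set x | exists2 y, odometer_paths w y & tail_equiv x y].

(* The tail-invariant probability of the odometer, viewed as a measure on X_B
   concentrated on the paths of the odometer. All finite paths of length n in
   the odometer end at w n. *)
Definition odometer_measure (B : bratteli) (R : realType)
    (w : forall n, vertex B n) (mubar : probability (borel_path B) R) : Prop :=
  mubar (odometer_paths w) = 1%E /\
  forall (x y : path_space B) (n : nat), odometer_paths w x -> odometer_paths w y ->
    mubar (cylinder x n `&` odometer_paths w) =
    mubar (cylinder y n `&` odometer_paths w).

Definition extension_of (B : bratteli) (R : realType)
    (w : forall n, vertex B n) (mubar : probability (borel_path B) R)
    (muhat : {measure set (borel_path B) -> \bar R}%R) : Prop :=
  [/\ holonomy_invariant muhat,
      forall A : set (borel_path B), measurable A ->
        A `<=` odometer_paths w -> muhat A = mubar A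
    & muhat (~` odometer_saturation w) = 0%E].

Definition extends_from_odometer (B : bratteli) (R : realType)
    (w : forall n, vertex B n) (mu : probability (borel_path B) R) : Prop :=
  exists (mubar : probability (borel_path B) R)
         (muhat : {measure set (borel_path B) -> \bar R}%R),
    [/\ odometer_measure w mubar, extension_of w mubar muhat
      & exists2 c : R, (0 < c)%R &
          forall A : set (borel_path B), measurable A ->
            mu A = (c%:E * muhat A)%E].

Definition mx2 (a c d b : nat) : 'M[nat]_2 :=
  (\matrix_(i, j) if i == ord0 then (if j == ord0 then a else c)
                  else (if j == ord0 then d else b))%R.

(* [lab n] numbers the two vertices of V_{n+1}, which makes F_{n+1} a 2 x 2
   matrix.  The values of a, b, c, d, r at 0 are not used. *)
Definition two_by_two_equal_row_sum (B : bratteli)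
    (lab : forall n, 'I_2 -> vertex B n.+1)
    (r0 : nat) (a b c d r : nat -> nat) : Prop :=
  [/\ forall n, bijective (lab n),
      forall (v : vertex B 1) (w : vertex B 0), incidence v w = r0,
      forall n, (\matrix_(i, j) incidence (lab n.+1 i) (lab n j))%R =
                mx2 (a n.+1) (c n.+1) (d n.+1) (b n.+1)
    & forall n, (a n.+1 + c n.+1 = r n.+1)%N /\ (d n.+1 + b n.+1 = r n.+1)%N].

Section series.

Local Open Scope ring_scope.
Variables (R : realType) (a d r : nat -> nat).

Definition sum_diff : \bar R :=
  (\sum_(1 <= k <oo) (1 - `|(a k)%:R - (d k)%:R| / (r k)%:R : R)%:E)%E.

Definition sum_max : \bar R :=
  (\sum_(1 <= k <oo) (1 - (maxn (a k) (d k))%:R / (r k)%:R : R)%:E)%E.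

Definition sum_min : \bar R :=
  (\sum_(1 <= k <oo) ((minn (a k) (d k))%:R / (r k)%:R : R)%:E)%E.

Definition sum_min_min : \bar R :=
  (\sum_(1 <= k <oo) (Num.min ((minn (a k) (d k))%:R / (r k)%:R)
                        (1 - (maxn (a k) (d k))%:R / (r k)%:R) : R)%:E)%E.

End series.

(* Main.v *)
Require Import Defs.
From HB Require Import structures.
From mathcomp Require Import all_boot all_order all_algebra.
From mathcomp Require Import all_classical all_reals all_analysis.
From mathcomp Require Import ring lra zify.

Set Implicit Arguments.
Unset Strict Implicit.
Unset Printing Implicit Defensive.

Import Order.TTheory GRing.Theory Num.Theory.

Local Open Scope classical_set_scope.

(** An invariant probability [mu] is determined by the masses of the cylinders:
    by invariance, all cylinders that end at a vertex [v] have the same mass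
    [p v], and cutting a cylinder according to its next edge shows that [p] is
    harmonic: [p v] is the sum of [p (erng e)] over the edges [e] that leave [v].
    Conversely every nonnegative harmonic [p] with value 1 at the root comes from
    a measure (harmonic_probability).  With equal row sums the number of finite
    paths from the root to [v] depends on the level of [v] only, so that the
    products of this number and of [p v] form a probability vector [Q_n] on each
    level, with [Q_n = (F_n / r_n)^T Q_(n+1)].  For two vertices per level the first
    coordinate satisfies
      [x_n = d_n / r_n + ((a_n - d_n) / r_n) x_(n+1)],
    an affine map that multiplies distances by [|a_n - d_n| / r_n].

    If the series of [1 - |a_n - d_n| / r_n] diverges, the products of these
    factors vanish, so two invariant measures have the same masses
    (same_measure_of_divergent); one exists because the normalized numbers of
    paths towards far away vertices are harmonic in the limit (limit_invariant).

    If the series converges, [F_n / r_n] is summably close to the identity or to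
    the transposition.  Following these permutations from each of the two vertices
    of the first level gives two disjoint odometers, along which all products of
    the proportions [f / r_n] (share) are positive and the late ones are close
    to 1.  A walk that goes down from a far away vertex of such an odometer along
    random edges probably stays on it, so a limit of these walks gives full mass to
    the tail class of the odometer (carried_exists).  Since the maps between levels
    do not increase distances, an invariant measure with this property is unique
    (same_measure_of_carried); applied to its restrictions to tail-invariant sets,
    this uniqueness makes it ergodic.  Every invariant measure lives on the union
    of the two tail classes (carried_cover), so an ergodic one lives on one of
    them, and there are exactly two.  Each is a multiple of the extension of its
    normalized restriction to the paths of the odometer
    (full_saturation_extends).

    Conversely a measure that comes from an odometer charges its path set, whose
    mass is at most any product of shares; hence the shares of the odometer are
    summably close to 1 (extends_summable_defect).  Every entry of [F_n] misses
    [r_n] by at least the minimum of [min a_n d_n] and [r_n - max a_n d_n], which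
    excludes odometers when these minima, divided by [r_n], have an infinite sum.
    In the two examples one vertex of each level from the second on receives all of
    its edges from a single vertex, so that this sum is 0, while the factors [|a_n - d_n| / r_n] are
    all [2 / 3].  If that vertex is always the first one, it carries an odometer of
    full mass; if it alternates, every odometer has infinitely many shares at most
    [2 / 3]. *)

Local Notation invariant := Defs.invariant (only parsing).

(** * Paths and cylinders *)

Section paths.
Variable B : bratteli.
Implicit Types x y z : path_space B.

Lemma erng_pedge x n : erng (pedge x n) = pvertex x n.+1.
Proof. by have := set_valP x; apply. Qed.

Lemma path_ext x y : (forall n, pedge x n = pedge y n) -> x = y.
Proof. by move=> xy; apply/val_inj/functional_extensionality_dep => n; exact: xy. Qed.

Lemma path_of_edges (f : forall n, edge B n) :
  (forall n, erng (f n) = esrc (f n.+1)) ->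
  exists x, forall n, pedge x n = f n.
Proof.
move=> fP; have {}fP : path_set B f by [].
by exists (SigSub (mem_set fP) : path_space B).
Qed.

Lemma vertex0_eq (v w : vertex B 0) : v = w.
Proof.
have /eq_leq/card_le1_eqP := card_vertex0 B; exact.
Qed.

(** All paths are built from this: at each vertex, an edge that satisfies the
    wish [P] is taken if there is one. *)
Lemma greedy_path (P : forall n, edge B n -> Prop) :
  exists x, forall n, (exists2 e, esrc e = pvertex x n & P n e) -> P n (pedge x n).
Proof.
pose choosable n (v : vertex B n) e := esrc e = v /\
  ((exists2 e', esrc e' = v & P n e') -> P n e).
have ex n v : exists e, choosable n v e.
  have [[e ev Pe]|nP] := pselect (exists2 e', esrc e' = v & P n e').
    by exists e.
  by have [e ev] := esrc_surj v; exists e.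
pose nxt n v := projT1 (cid (ex n v)).
have nxtP n v : choosable n v (nxt n v) by exact: (projT2 (cid (ex n v))).
have v0 : vertex B 0.
  by have /card_gt0P/sigW[] : 0 < #|vertex B 0| by rewrite card_vertex0.
pose fix vs n : vertex B n := if n is m.+1 then erng (nxt m (vs m)) else v0.
have [|x xE] := @path_of_edges (fun n => nxt n (vs n)).
  by move=> n; have [-> _] := nxtP n.+1 (vs n.+1).
exists x => n; rewrite /pvertex xE; have [-> h] := nxtP n (vs n).
exact: h.
Qed.

Lemma cylinder_sym x y n : cylinder x n y -> cylinder y n x.
Proof. by move=> xy i /xy. Qed.

Lemma cylinder_trans x y z n : cylinder x n y -> cylinder y n z -> cylinder x n z.
Proof. by move=> xy yz i ik; rewrite yz // xy. Qed.

Lemma cylinder_le x y m n : (m <= n)%N -> cylinder x n y -> cylinder x m y.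
Proof. by move=> mn xy i im; apply: xy; exact: leq_trans mn. Qed.

Lemma cylinder_eq x y n : cylinder x n y -> cylinder x n = cylinder y n.
Proof.
move=> xy; apply/seteqP; split=> z; apply: cylinder_trans => //.
exact: cylinder_sym.
Qed.

Lemma cylinder_pvertex x y n i :
  cylinder x n y -> (i <= n)%N -> pvertex y i = pvertex x i.
Proof.
case: i => [|i] xy ik; first exact: vertex0_eq.
by rewrite -!erng_pedge xy.
Qed.

Lemma cylinder0 x : cylinder x 0 = setT.
Proof. by apply/seteqP; split=> // y _ i. Qed.

Lemma cylinderS x n :
  cylinder x n.+1 = cylinder x n `&` [set y | pedge y n = pedge x n].
Proof.
apply/seteqP; split=> [y xy|y [xy yn] i].
  by split; [apply: cylinder_le xy | exact: xy].
by rewrite ltnS leq_eqVlt => /predU1P[->//|/xy].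
Qed.

(** The wish for the levels below [n] is the edge of [x], and for level [n] it is
    [e], transported along the equation between levels. *)
Lemma extend_path x n (e : edge B n) : esrc e = pvertex x n ->
  exists2 y, cylinder x n y & pedge y n = e.
Proof.
move=> ex; have [y yP] := greedy_path (fun i e' =>
  ((i < n)%N -> e' = pedge x i) /\
  forall h : n = i, e' = eq_rect n (fun j => edge B j) e i h).
have xy : cylinder x n y.
  suff : forall m, (m <= n)%N -> cylinder x m y by apply.
  elim=> [|m IH mn]; first by rewrite cylinder0.
  have {}IH := IH (ltnW mn).
  rewrite cylinderS; split=> //=.
  have [|+ _] := yP m; last exact.
  exists (pedge x m); first by rewrite (cylinder_pvertex IH).
  by split=> // h; exfalso; move: mn; rewrite h ltnn.
exists y => //; have [|_ /(_ erefl)//] := yP n.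
exists e; first by rewrite (cylinder_pvertex xy).
by split=> [|h]; [rewrite ltnn | rewrite eq_axiomK].
Qed.

Lemma path_through n (v : vertex B n) : exists x, pvertex x n = v.
Proof.
elim: n v => [|n IH] v.
  by have [x _] := path_inhabited B; exists x; exact: vertex0_eq.
have [e ev] := erng_surj v; have [x xe] := IH (esrc e).
have [y _ ye] := extend_path (esym xe).
by exists y; rewrite -erng_pedge ye.
Qed.

Definition splice_fun x n z i := if (i < n)%N then pedge x i else pedge z i.

Lemma splice_path x n z :
  pvertex x n = pvertex z n -> path_set B (splice_fun x n z).
Proof.
move=> xz i; rewrite /splice_fun.
have [ik|ik|ik] := ltngtP i.+1 n.
- exact: erng_pedge.
- exact: erng_pedge.
- by rewrite erng_pedge -[RHS]/(pvertex z i.+1) ik.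
Qed.

(** Total, so that preimages under it make sense: [z] is returned unchanged when
    the prefix of [x] cannot be put in front of it. *)
Definition splice x n z : path_space B :=
  if pselect (pvertex x n = pvertex z n) is left xz
  then SigSub (mem_set (splice_path xz)) else z.

Lemma splice_lt x n z i : pvertex x n = pvertex z n -> (i < n)%N ->
  pedge (splice x n z) i = pedge x i.
Proof.
move=> xz ik; rewrite /splice; case: pselect => // h.
by rewrite -[LHS]/(splice_fun x n z i) /splice_fun ik.
Qed.

Lemma splice_ge x n z i : (n <= i)%N -> pedge (splice x n z) i = pedge z i.
Proof.
move=> ni; rewrite /splice; case: pselect => // h.
by rewrite -[LHS]/(splice_fun x n z i) /splice_fun ltnNge ni.
Qed.

Lemma splice_cylinder x n z : pvertex x n = pvertex z n ->
  cylinder x n (splice x n z).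
Proof. by move=> xz i ik; rewrite splice_lt. Qed.

Lemma pvertex_splice x n z i : (n <= i)%N ->
  pvertex (splice x n z) i = pvertex z i.
Proof. by move=> ni; rewrite /pvertex splice_ge. Qed.

End paths.

Section topology.
Variable B : bratteli.
Implicit Types x y z : path_space B.

Lemma pedge_continuous n :
  continuous (fun x : path_space B => pedge x n : discrete_topology (edge B n)).
Proof.
move=> x; apply: (@continuous_comp (path_space B)
  (prod_topology (fun n => discrete_topology (edge B n))) _ set_val (proj n)).
  exact: initial_continuous.
exact: proj_continuous.
Qed.

Lemma cylinder_open x n : open (cylinder x n).
Proof.
elim: n => [|n IH]; first by rewrite cylinder0; exact: openT.
rewrite cylinderS; apply: openI => //.
apply: (@open_comp _ (discrete_topology (edge B n)) _ [set pedge x n]).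
  by move=> y _; exact: pedge_continuous.
exact: discrete_open.
Qed.

(** The sets that contain a cylinder around [x] form a filter that converges to
    [x] in each coordinate, hence in the product topology. *)
Lemma nbhs_cylinder x (U : set (path_space B)) :
  nbhs x U -> exists n, cylinder x n `<=` U.
Proof.
case=> _ [[W oW <-] Wx WU].
pose cyl n : set (prod_topology (fun n => discrete_topology (edge B n))) :=
  [set f | forall i, (i < n)%N -> f i = set_val x i].
pose F := filter_from setT cyl.
have FF : Filter F.
  apply: filter_from_filter; first by exists 0%N.
  move=> i j _ _; exists (maxn i j) => // f fx.
  by split=> k kl; apply: fx; rewrite leq_max kl ?orbT.
have : F --> (set_val x : prod_topology (fun n => discrete_topology (edge B n))).
  apply/cvg_sup => i A [_ [[V oV <-] Vx VA]].
  exists i.+1 => // f fx; apply: VA => /=; rewrite fx//.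
move=> /(_ W)[|n _ nW]; first exact: open_nbhs_nbhs.
by exists n => y yx; apply: WU; apply: nW.
Qed.

Lemma open_cylinders (U : set (path_space B)) m : open U ->
  U = \bigcup_k [set x | cylinder x (m + k) `<=` U].
Proof.
move=> oU; apply/seteqP; split=> [x Ux|x [k _]]; last exact.
have [n nU] := nbhs_cylinder (open_nbhs_nbhs (conj oU Ux)).
exists n => // y yx; apply: nU; apply: cylinder_le yx; exact: leq_addl.
Qed.

(** [set0] makes the family closed under intersection.  Any bound [m] on the
    lengths gives a generating family; changes of prefixes of length [m] map its
    members to cylinders. *)
Definition long_cylinders m : set (set (path_space B)) :=
  [set C | C = set0 \/ exists x k, (m <= k)%N /\ C = cylinder x k].

Lemma long_cylinders_setI m : setI_closed (long_cylinders m).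
Proof.
move=> C D [->|[x [k [mk ->]]]]; first by rewrite set0I; left.
case=> [->|[y [l [ml ->]]]]; first by rewrite setI0; left.
have [C0|/set0P[z [zx zy]]] := eqVneq (cylinder x k `&` cylinder y l) set0.
  by left.
right; exists z, (maxn k l); split; first by rewrite leq_max mk.
apply/seteqP; split=> [u [ux uy] i|u uz].
  by rewrite leq_max => /orP[ik|il]; [rewrite ux// zx|rewrite uy// zy].
split.
  by apply: cylinder_trans zx _; apply: cylinder_le uz; rewrite leq_maxl.
by apply: cylinder_trans zy _; apply: cylinder_le uz; rewrite leq_maxr.
Qed.

(** Finitely many cylinders of length [n] cover the path space, so a set that
    only looks at the first [n] edges is a finite union of them. *)
Lemma determined_measurable m n (A : set (path_space B)) : (m <= n)%N ->
  (forall x y, cylinder x n y -> A x -> A y) -> <<s long_cylinders m >> A.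
Proof.
move=> mn Adet.
pose C (g : {dffun forall i : 'I_n, edge B i}) :=
  A `&` [set y | forall i : 'I_n, pedge y i = g i].
have -> : A = \bigcup_(g in [set: {dffun forall i : 'I_n, edge B i}]) C g.
  apply/seteqP; split=> [x Ax|x [g _ []//]].
  by exists [ffun i : 'I_n => pedge x i] => //; split => //= i; rewrite ffunE.
apply: (@fin_bigcup_measurable _ (g_sigma_algebraType (long_cylinders m))) => //.
move=> g _; apply: sub_gen_smallest.
have [->|/set0P[x [Ax xg]]] := eqVneq (C g) set0; first by left.
right; exists x, n; split=> //; apply/seteqP; split=> [y [_ yg] i ik|y yx].
  by rewrite (yg (Ordinal ik)) (xg (Ordinal ik)).
split; first exact: Adet yx Ax.
by move=> i; rewrite yx ?xg.
Qed.

Lemma borel_cylinders m :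
  @measurable _ (borel_path B) = <<s long_cylinders m >>.
Proof.
apply/seteqP; split.
  apply: smallest_sub; first exact: smallest_sigma_algebra.
  move=> U /(open_cylinders m) ->.
  apply: (@bigcupT_measurable _ (g_sigma_algebraType (long_cylinders m))) => k.
  apply: (determined_measurable (leq_addr k m)) => x y xy.
  by rewrite /= (cylinder_eq xy).
apply: smallest_sub; first exact: smallest_sigma_algebra.
move=> _ [->|[x [k [_ ->]]]]; first exact: (@measurable0 _ (borel_path B)).
by apply: sub_gen_smallest; exact: cylinder_open.
Qed.

Lemma cylinder_measurable x n : measurable (cylinder x n : set (borel_path B)).
Proof. by apply: sub_gen_smallest; exact: cylinder_open. Qed.

Lemma measurable_determined n (A : set (borel_path B)) :
  (forall x y, cylinder x n y -> A x -> A y) -> measurable A.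
Proof. by move=> AP; rewrite (borel_cylinders 0); exact: determined_measurable AP. Qed.

Section measure.
Local Open Scope ring_scope.
Variable R : realType.
Implicit Types m : {measure set (borel_path B) -> \bar R}.

Lemma cylinder_measure_unique m1 m2 l : m1 setT = m2 setT ->
  (m1 setT < +oo)%E ->
  (forall x k, (l <= k)%N -> m1 (cylinder x k) = m2 (cylinder x k)) ->
  forall A, measurable A -> m1 A = m2 A.
Proof.
move=> eqT fin eqC A mA.
have H : [set X | long_cylinders l X /\ X `<=` setT] = long_cylinders l.
  by apply/seteqP; split=> [X []//|X lX]; split.
apply: (@g_sigma_algebra_measure_unique_trace _ R (borel_path B)
  (long_cylinders l) setT measurableT _ _ m1 m2 eqT _ fin _ A); rewrite ?H.
- by move=> _ [->|[x [k [_ ->]]]]; [exact: measurable0|exact: cylinder_measurable].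
- exact: long_cylinders_setI.
- by move=> _ [->|[x [k [lk ->]]]]; rewrite ?measure0 ?eqC.
- by [].
- by move: mA; rewrite (borel_cylinders l).
Qed.

Lemma measure_split n m (A : set (borel_path B)) : measurable A ->
  m A = (\sum_(e : edge B n) m (A `&` [set x | pedge x n = e]))%E.
Proof.
move=> mA.
have mF e : measurable (A `&` [set x | pedge x n = e] : set (borel_path B)).
  apply: measurableI => //; apply: (@measurable_determined n.+1).
  by move=> x y xy /= <-; rewrite xy.
have {1}-> : A = \bigcup_(e in [set: edge B n]) (A `&` [set x | pedge x n = e]).
  by apply/seteqP; split=> [x Ax|x [e _ []//]]; exists (pedge x n).
rewrite measure_fin_bigcup//; first last.
- by move=> e f _ _ [x [[_ <-] [_ <-]]].
- exact: finite_finset.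
have -> : [set: edge B n] = [set` index_enum (edge B n)].
  by apply/seteqP; split=> e //= _; exact: mem_index_enum.
by rewrite -fsbig_seq// index_enum_uniq.
Qed.

Lemma measure_cylinder_split n m x (s : vertex B n.+1 -> \bar R) :
  (forall y, cylinder x n y -> m (cylinder y n.+1) = s (pvertex y n.+1)) ->
  m (cylinder x n) =
  (\sum_(e : edge B n | esrc e == pvertex x n) s (erng e))%E.
Proof.
move=> ms; rewrite (measure_split n _ (cylinder_measurable x n)).
rewrite [RHS]big_mkcond/=; apply: eq_bigr => e _; case: ifPn => [/eqP ex|/eqP ex].
  have [y xy ye] := extend_path ex.
  have -> : cylinder x n `&` [set x0 | pedge x0 n = e] = cylinder y n.+1.
    by rewrite cylinderS (cylinder_eq xy) ye.
  by rewrite ms// -erng_pedge ye.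
rewrite (_ : _ `&` _ = set0) ?measure0//; apply/seteqP; split=> // y [xy ye].
by apply: ex; rewrite -ye; exact: (cylinder_pvertex xy).
Qed.

End measure.
End topology.

(** * Measures with prescribed harmonic masses *)

Lemma normalized_probability d (T : measurableType d) (R : realType)
    (m : {measure set T -> \bar R}%R) : (0 < m setT)%E -> (m setT < +oo)%E ->
  exists P : probability T R,
    forall A, P A = (m A * (fine (m setT))^-1%:E)%E.
Proof.
move=> m0 moo; exists (mnormalize m (dirac (point : T))) => A.
by rewrite /= /mnormalize gt_eqF//= lt_eqF.
Qed.

Section cumulative.
Local Open Scope ring_scope.
Variables (R : realType) (T : finType) (W : T -> R).
Hypothesis W0 : forall e, 0 <= W e.

Definition cumulative (e : T) : R :=
  \sum_(f <- take (index e (index_enum T)) (index_enum T)) W f.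

Lemma cumulative_ge0 e : 0 <= cumulative e.
Proof. by apply: sumr_ge0. Qed.

Lemma cumulative_next e f : (index e (index_enum T) < index f (index_enum T))%N ->
  cumulative e + W e <= cumulative f.
Proof.
rewrite /cumulative; set s := index_enum T => ef.
have es : e \in s by exact: mem_index_enum.
rewrite -(cat_take_drop (index e s).+1 (take (index f s) s)) -take_min (minn_idPl ef).
rewrite (take_nth e) ?index_mem// nth_index// big_cat big_rcons/=.
by rewrite -addrA lerD2l lerDl sumr_ge0.
Qed.

Lemma cumulative_le e : cumulative e + W e <= \sum_f W f.
Proof.
rewrite /cumulative; set s := index_enum T.
have es : e \in s by exact: mem_index_enum.
rewrite -[X in _ <= \sum_(f <- X) _](cat_take_drop (index e s).+1 s).
rewrite (take_nth e) ?index_mem// nth_index// big_cat big_rcons/=.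
by rewrite lerDl sumr_ge0.
Qed.

(** The intervals of lengths [W e], laid end to end in the order of the
    enumeration, tile the interval whose length is the sum. *)
Lemma cumulative_exists t : 0 <= t < \sum_e W e ->
  exists e, cumulative e <= t < cumulative e + W e.
Proof.
rewrite /cumulative; have : uniq (index_enum T) := index_enum_uniq T.
suff : forall (s : seq T) u, 0 <= u < \sum_(e <- s) W e ->
    exists s1 e s2, s = s1 ++ e :: s2 /\
      \sum_(f <- s1) W f <= u < \sum_(f <- s1) W f + W e.
  move=> /(_ (index_enum T) t) h us /h [s1 [e [s2 [sE tE]]]]; exists e.
  have es1 : e \notin s1.
    by move: us; rewrite sE cat_uniq /= => /and3P[_ /norP[]].
  rewrite sE index_cat (negbTE es1) /= eqxx addn0 take_size_cat//.
elim=> [|e s IH] u; first by rewrite big_nil => /andP[/le_lt_trans h /h]; rewrite ltxx.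
rewrite big_cons => /andP[u0 us].
have [ue|eu] := ltP u (W e).
  by exists [::], e, s; split=> //; rewrite big_nil add0r u0.
have [|s1 [f [s2 [-> fu]]]] := IH (u - W e).
  by rewrite subr_ge0 eu/= ltrBlDl.
exists (e :: s1), f, s2; split=> //; rewrite big_cons -addrA.
by rewrite -lerBrDl -ltrBlDl.
Qed.

Lemma cumulative_inj e f t : cumulative e <= t < cumulative e + W e ->
  cumulative f <= t < cumulative f + W f -> e = f.
Proof.
move=> /andP[et te] /andP[ft tf].
have [ef|fe|] := ltngtP (index e (index_enum T)) (index f (index_enum T)).
- have := lt_le_trans te (le_trans (cumulative_next ef) ft); by rewrite ltxx.
- have := lt_le_trans tf (le_trans (cumulative_next fe) et); by rewrite ltxx.
- by move=> ef; have := nth_index e (mem_index_enum e); rewrite ef nth_index ?mem_index_enum.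
Qed.
End cumulative.

Section existence.
Local Open Scope ring_scope.
Variables (R : realType) (B : bratteli) (p : forall n, vertex B n -> R).
Hypothesis p1 : forall v, p (n := 0) v = 1.
Hypothesis p_ge0 : forall n (v : vertex B n), 0 <= p v.
Hypothesis pS : forall n (v : vertex B n), p v = \sum_(e | esrc e == v) p (erng e).
Implicit Types x y : path_space B.

Let W n (v : vertex B n) (e : edge B n) := if esrc e == v then p (erng e) else 0.
Let cum n (v : vertex B n) (e : edge B n) : R := cumulative (W v) e.

Let W0 n (v : vertex B n) e : 0 <= W v e.
Proof. by rewrite /W; case: ifP. Qed.

Let sumW n (v : vertex B n) : \sum_e W v e = p v.
Proof. by rewrite pS [RHS]big_mkcond. Qed.

Let nxt_ex n (v : vertex B n) (t : R) : exists e : edge B n, esrc e = v /\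
  (0 <= t < p v -> cum v e <= t < cum v e + W v e).
Proof.
have [tv|tv] := boolP (0 <= t < p v); last by have [e] := esrc_surj v; exists e.
have [|e et] := @cumulative_exists R _ (W v) t; first by rewrite sumW.
exists e; split=> //; case/andP: et => et; rewrite /W.
case: eqP => // _; rewrite addr0 => /(le_lt_trans et); by rewrite ltxx.
Qed.

Let nxt n (v : vertex B n) t := projT1 (cid (nxt_ex v t)).

Let v0 : vertex B 0 := pvertex (projT1 (cid (path_inhabited B))) 0.

(** The current vertex, and the position of [u] in the interval of length [p v]
    that this vertex [v] stands for. *)
Let state (u : R) := fix st n : vertex B n * R :=
  if n is m.+1 then let e := nxt (st m).1 (st m).2 in
    (erng e, (st m).2 - cum (st m).1 e) else (v0, u).

Let path_ex u : exists x, forall n, pedge x n = nxt (state u n).1 (state u n).2.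
Proof.
apply: path_of_edges => n; rewrite {2}/nxt; case: cid => e [/= -> _]//.
Qed.

Let path u := projT1 (cid (path_ex u)).
Let pedge_path u n : pedge (path u) n = nxt (state u n).1 (state u n).2.
Proof. exact: (projT2 (cid (path_ex u)) n). Qed.

(** The left end of the subinterval of [0, 1[ that codes the cylinder. *)
Let left_end x n : R := \sum_(i < n) cum (pvertex x i) (pedge x i).

Let left_endS x n :
  left_end x n.+1 = left_end x n + cum (pvertex x n) (pedge x n).
Proof. by rewrite /left_end big_ord_recr. Qed.

Let pvertex_path u n : pvertex (path u) n = (state u n).1.
Proof. by rewrite /pvertex pedge_path /nxt; case: cid => e []. Qed.

Let residual u n : (state u n).2 = u - left_end (path u) n.
Proof.
elim: n => [|n IH]; first by rewrite /left_end big_ord0 subr0.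
by rewrite left_endS opprD addrA -IH /= pvertex_path pedge_path.
Qed.

Let W_edge x n : W (pvertex x n) (pedge x n) = p (pvertex x n.+1).
Proof. by rewrite /W eqxx erng_pedge. Qed.

Let residual_itv u n : 0 <= u < 1 -> 0 <= (state u n).2 < p (state u n).1.
Proof.
move=> u01; elim: n => [|n IH]; first by rewrite /= p1.
rewrite -pvertex_path -W_edge pvertex_path pedge_path /=.
rewrite /nxt; case: cid => e [/= es /(_ IH)].
by rewrite subr_ge0 ltrBlDl.
Qed.

Let left_end_bounds x n : 0 <= left_end x n /\ left_end x n + p (pvertex x n) <= 1.
Proof.
elim: n => [|n [IH1 IH2]]; first by rewrite /left_end big_ord0 add0r p1.
rewrite left_endS addr_ge0 ?cumulative_ge0//; split=> //.
apply: le_trans IH2; rewrite -addrA lerD2l -W_edge -sumW; exact: cumulative_le.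
Qed.

Let path_cylinder x n u : 0 <= u < 1 ->
  cylinder x n (path u) <-> left_end x n <= u < left_end x n + p (pvertex x n).
Proof.
move=> u01; split=> [xu|].
  have -> : left_end x n = left_end (path u) n.
    apply: eq_bigr => i _; rewrite xu// (cylinder_pvertex xu)//; exact: ltnW.
  have := residual_itv n u01.
  by rewrite residual subr_ge0 ltrBlDl -pvertex_path (cylinder_pvertex xu).
elim: n => [|n IH]; first by rewrite cylinder0.
rewrite left_endS => /andP[lu ul].
have xu : cylinder x n (path u).
  apply: IH; apply/andP; split.
    by apply: le_trans lu; rewrite lerDl cumulative_ge0.
  apply: lt_le_trans ul _; rewrite -addrA lerD2l -W_edge -sumW.
  exact: cumulative_le.
rewrite cylinderS; split=> //=.
have vE : pvertex (path u) n = pvertex x n := cylinder_pvertex xu (leqnn n).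
have lE : left_end x n = left_end (path u) n.
  apply: eq_bigr => i _; rewrite xu// (cylinder_pvertex xu)//; exact: ltnW.
apply: (@cumulative_inj _ _ (W (pvertex x n)) (W0 _) _ _ (state u n).2).
  rewrite -[cumulative _ _]/(cum _ _) pedge_path -vE pvertex_path.
  by rewrite /nxt; case: cid => e [/= _]; apply; exact: residual_itv.
by rewrite W_edge residual -lE lerBrDl ltrBlDl addrA lu.
Qed.

Let clip (u : R) : R := if 0 <= u < 1 then u else 0.

Let code (u : measurableTypeR R) : borel_path B := path (clip u).

Let code_cylinder x n : code @^-1` cylinder x n `&` [set` `[0, 1[ ] =
  [set` `[left_end x n, left_end x n + p (pvertex x n)[ ].
Proof.
have [l0 l1] := left_end_bounds x n.
apply/seteqP; split=> u /=; rewrite !in_itv/=.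
  move=> [+ u01]; rewrite /code/= /clip u01 => /path_cylinder; exact.
move=> ul; have u01 : 0 <= u < 1.
  case/andP: ul => lu ul; rewrite (le_trans l0)//=; exact: lt_le_trans l1.
by split=> //; rewrite /code/= /clip u01; apply/path_cylinder.
Qed.

Let measurable_code : measurable_fun setT code.
Proof.
apply: (@measurability _ _ (measurableTypeR R) (borel_path B) setT code _ (borel_cylinders B 0)).
move=> _ [_ [->|[x [n [_ ->]]]] <-]; rewrite setTI ?preimage_set0//.
rewrite -(setUIDK (code @^-1` _) [set` `[0, 1[ ]); apply: measurableU.
  by rewrite code_cylinder; exact: measurable_itv.
have [x0|x0] := pselect (cylinder x n (path 0)).
  rewrite (_ : _ `\` _ = ~` [set` `[0, 1[ ]); first by apply: measurableC; exact: measurable_itv.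
  apply/seteqP; split=> [u [] //|u u01]; split=> //.
  by rewrite /= /code/= /clip; move: u01; rewrite /= in_itv/= => /negP/negbTE ->.
rewrite (_ : _ `\` _ = set0)//; apply/seteqP; split=> // u [/= + u01].
by rewrite /code/= /clip; move: u01; rewrite /= in_itv/= => /negP/negbTE ->.
Qed.

(** The fair choice of a number in [0, 1[ is spent edge by edge: a vertex [v]
    cuts the interval of length [p v] it has been given into intervals of
    lengths [p (erng e)], one for each edge [e] that leaves [v]. *)
Lemma harmonic_probability : exists mu : probability (borel_path B) R,
  forall x n, mu (cylinder x n) = (p (pvertex x n))%:E.
Proof.
pose leb : {measure set (measurableTypeR R) -> \bar R} := @lebesgue_measure R.
pose unif : {measure set (measurableTypeR R) -> \bar R} :=
  mrestr leb (measurable_itv `[0, 1[).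
have unifT : unif setT = 1%E.
  by rewrite /unif/= /mrestr setTI /leb lebesgue_measure_itv/= lte01 sube0.
have [||P PE] := @normalized_probability _ _ _ unif; rewrite ?unifT ?ltry//.
pose X : {mfun (measurableTypeR R) >-> borel_path B} :=
  mfun_Sub (mem_set measurable_code).
exists (distribution P X) => x n.
rewrite -[LHS]/(P (code @^-1` cylinder x n)) PE unifT invr1 mule1.
rewrite -[LHS]/(leb (code @^-1` cylinder x n `&` [set` `[0, 1[ ])) code_cylinder.
rewrite -[LHS]/(@lebesgue_measure R [set` `[left_end x n, left_end x n + p (pvertex x n)[ ]).
rewrite lebesgue_measure_itv/= lte_fin ltrDl.
case: ltP => [_|]; first by rewrite -EFinB addrAC subrr add0r.
by move=> pn0; rewrite (@le_anti _ _ (p (pvertex x n)) 0)// pn0 p_ge0.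
Qed.

End existence.

(** * Invariant measures and equal row sums *)

Section holonomy.
Local Open Scope ring_scope.
Variables (R : realType) (B : bratteli).
Implicit Types (x y z : path_space B) (mu nu : probability (borel_path B) R).

Lemma cylinder_splice x n z z' k : (n <= k)%N -> cylinder z k z' ->
  cylinder (splice x n z) k (splice x n z').
Proof.
move=> nk zz' i ik; have vE := cylinder_pvertex zz' nk.
have [ni|ni] := leqP n i; first by rewrite !splice_ge// zz'.
rewrite /splice; case: pselect => h; case: pselect => h' //.
- by rewrite -[LHS]/(splice_fun x n z' i) -[RHS]/(splice_fun x n z i) /splice_fun ni.
- by exfalso; apply: h'; rewrite h.
- by exfalso; apply: h; rewrite h'.
- exact: zz'.
Qed.

Lemma measurable_splice x n :
  measurable_fun setT (splice x n : borel_path B -> borel_path B).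
Proof.
apply: (@measurability _ _ (borel_path B) (borel_path B) setT _ _
  (borel_cylinders B n)).
move=> _ [_ [->|[u [k [nk ->]]]] <-]; rewrite setTI ?preimage_set0//.
apply: (@measurable_determined _ k) => z z' zz' /= uz.
by apply: cylinder_trans uz _; exact: cylinder_splice.
Qed.

Lemma switch_prefixE x y n (A : set (path_space B)) :
  pvertex x n = pvertex y n -> A `<=` cylinder x n ->
  switch_prefix y n A = splice x n @^-1` A `&` cylinder y n.
Proof.
move=> xy Ax; apply/seteqP; split=> z.
  move=> [yz [z' Az' zz']]; split=> //=.
  suff -> : splice x n z = z' by [].
  have xz : pvertex x n = pvertex z n by rewrite xy (cylinder_pvertex yz).
  apply: path_ext => i; have [ni|ni] := leqP n i.
    by rewrite splice_ge// zz'.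
  by rewrite splice_lt// Ax.
move=> [/= Az yz]; split=> //; exists (splice x n z) => // i ni.
by rewrite splice_ge.
Qed.

(** Switching prefixes is a bijection between two cylinders that end at the
    same vertex, and maps subcylinders to subcylinders with the same end vertex;
    so the two measures to compare agree on all long cylinders. *)
Lemma invariant_holonomy mu : invariant mu -> holonomy_invariant mu.
Proof.
move=> inv x y n A xy mA Ax; rewrite (switch_prefixE xy Ax).
pose m1 : {measure set (borel_path B) -> \bar R} :=
  mrestr mu (cylinder_measurable x n).
pose m2' : {measure set (borel_path B) -> \bar R} :=
  mrestr mu (cylinder_measurable y n).
pose push : {measure set (borel_path B) -> \bar R} :=
  pushforward m2' (splice x n : borel_path B -> borel_path B).
pose m2 := push (measurable_splice x n).
have m2E C : m2 C = mu (splice x n @^-1` C `&` cylinder y n) by [].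
have m1E C : m1 C = mu (C `&` cylinder x n) by [].
have -> : mu A = m1 A by rewrite m1E setIidl.
rewrite -m2E; apply: (@cylinder_measure_unique _ _ m1 m2 n) => //.
- by rewrite m1E m2E preimage_setT !setTI; exact: inv.
- rewrite m1E (le_lt_trans (probability_le1 _ _)) ?ltry//.
  by rewrite setTI; exact: cylinder_measurable.
move=> u k nk; rewrite m1E m2E.
have [xu|xu] := pselect (cylinder x n u); last first.
  rewrite (_ : _ `&` cylinder x n = set0); last first.
    apply/seteqP; split=> // w [uw xw]; apply: xu.
    by apply: cylinder_trans xw _; apply/cylinder_sym; exact: cylinder_le uw.
  rewrite (_ : _ `&` _ = set0) ?measure0//.
  apply/seteqP; split=> // w [/= uw yw]; apply: xu.
  apply: (@cylinder_trans _ _ (splice x n w)).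
    by apply: splice_cylinder; rewrite (cylinder_pvertex yw).
  by apply/cylinder_sym; exact: cylinder_le uw.
rewrite setIidl; last first.
  by move=> w uw; apply: cylinder_trans xu _; exact: cylinder_le uw.
have yu : pvertex y n = pvertex u n by rewrite (cylinder_pvertex xu).
rewrite (_ : _ `&` cylinder y n = cylinder (splice y n u) k).
  by apply: inv; rewrite pvertex_splice.
apply/seteqP; split=> [w [/= uw yw] i ik|w uw].
  have [ni|ni] := leqP n i; last by rewrite splice_lt// yw.
  by rewrite splice_ge// -uw// splice_ge.
have yw : cylinder y n w.
  by apply: cylinder_trans (splice_cylinder yu) _; exact: cylinder_le uw.
split=> //= i ik.
have [ni|ni] := leqP n i; first by rewrite splice_ge// uw// splice_ge.
by rewrite splice_lt ?xu// (cylinder_pvertex yw).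
Qed.

Lemma invariant_tail_set mu n (S : set (borel_path B)) x y : invariant mu ->
  measurable S -> (forall z z', agree_from n z z' -> S z -> S z') ->
  pvertex x n = pvertex y n -> mu (S `&` cylinder x n) = mu (S `&` cylinder y n).
Proof.
move=> inv mS tailS xy.
have Sx : S `&` cylinder x n `<=` cylinder x n by exact: subIsetr.
rewrite (invariant_holonomy inv xy _ Sx); last first.
  by apply: measurableI => //; exact: cylinder_measurable.
rewrite (switch_prefixE xy Sx).
congr (mu _); apply/seteqP; split=> z [].
  move=> [/= Sz _ yz]; split=> //; apply: tailS Sz => i ni.
  by rewrite splice_ge.
move=> Sz yz; split=> //=; split; last first.
  by apply: splice_cylinder; rewrite (cylinder_pvertex yz).
by apply: tailS Sz => i ni; rewrite splice_ge.
Qed.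

End holonomy.

Section levels.
Local Open Scope ring_scope.
Variables (R : realType) (B : bratteli).
Implicit Types (x y z : path_space B) (mu nu : probability (borel_path B) R).

(** For an invariant measure the choice of the path to [v] does not matter. *)
Definition vertex_mass mu n (v : vertex B n) : R :=
  fine (mu (cylinder (projT1 (cid (path_through v))) n)).

Lemma cylinder_mass mu x n : invariant mu ->
  mu (cylinder x n) = (vertex_mass mu (pvertex x n))%:E.
Proof.
move=> inv; rewrite /vertex_mass fineK ?fin_num_measure//; last first.
  exact: cylinder_measurable.
by apply: inv; rewrite (projT2 (cid (path_through _))).
Qed.

Lemma vertex_mass_ge0 mu n (v : vertex B n) : 0 <= vertex_mass mu v.
Proof. by rewrite fine_ge0. Qed.

Lemma vertex_mass_split mu n (v : vertex B n) : invariant mu ->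
  vertex_mass mu v = \sum_(e | esrc e == v) vertex_mass mu (erng e).
Proof.
move=> inv; have [x <-] := path_through v.
apply: EFin_inj; rewrite -(cylinder_mass _ _ inv) -sumEFin.
apply: (@measure_cylinder_split _ _ n mu x (fun v => (vertex_mass mu v)%:E)).
by move=> y _; exact: cylinder_mass.
Qed.

Lemma same_measure_mass mu nu : invariant mu -> invariant nu ->
  (forall n (v : vertex B n), vertex_mass mu v = vertex_mass nu v) ->
  same_measure mu nu.
Proof.
move=> imu inu E; apply: (@cylinder_measure_unique _ _ mu nu 0).
- by rewrite [LHS](probability_setT mu) [RHS](probability_setT nu).
- by rewrite [X in (X < _)%E](probability_setT mu) ltry.
- by move=> x n _; rewrite [LHS]cylinder_mass// [RHS]cylinder_mass// E.
Qed.

Variable r : nat -> nat.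
Hypothesis rowsum : forall n (v : vertex B n.+1),
  (\sum_(w : vertex B n) incidence v w = r n)%N.

Lemma card_rng n (v : vertex B n.+1) : #|[pred e : edge B n | erng e == v]| = r n.
Proof.
rewrite -(rowsum v) /incidence -sum1_card (partition_big (@esrc B n) xpredT)//=.
apply: eq_bigr => w _; rewrite -sum1_card; apply: eq_bigl => e.
by rewrite !inE andbC.
Qed.

Lemma row_sum_gt0 n : (0 < r n)%N.
Proof.
have [x _] := path_inhabited B.
rewrite -(card_rng (erng (pedge x n))); apply/card_gt0P; exists (pedge x n).
by rewrite inE.
Qed.

(** The number of finite paths from the root to any given vertex of level [n]. *)
Definition height n : R := \prod_(k < n) (r k)%:R.

Lemma height_gt0 n : 0 < height n.
Proof. by apply: prodr_gt0 => k _; rewrite ltr0n row_sum_gt0. Qed.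

Lemma heightS n : height n.+1 = height n * (r n)%:R.
Proof. by rewrite /height big_ord_recr. Qed.

(** Summing over sources or over ranges: [r n] edges end at each vertex. *)
Lemma sum_edges n (s : vertex B n.+1 -> R) :
  \sum_w \sum_(e | esrc e == w) s (erng e) = (r n)%:R * \sum_v s v.
Proof.
rewrite (exchange_big_dep xpredT)//= (partition_big (@erng B n) xpredT)//=.
rewrite mulr_sumr; apply: eq_bigr => v _.
rewrite -(card_rng v) -sum1_card natr_sum mulr_suml; apply: eq_big => // e.
by move=> /eqP ->; rewrite mul1r (big_pred1 (esrc e))// => w; rewrite eq_sym.
Qed.

Lemma sum_vertex0 (s : vertex B 0 -> R) v : \sum_w s w = s v.
Proof. by apply: big_pred1 => w /=; rewrite (vertex0_eq w v) eqxx. Qed.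

(** Every vertex of level [n] is the end of exactly [height n] finite paths. *)
Lemma measure_level (m : {measure set (borel_path B) -> \bar R}) n
    (s : vertex B n -> R) :
  (forall x, m (cylinder x n) = (s (pvertex x n))%:E) ->
  m setT = (height n * \sum_v s v)%:E.
Proof.
elim: n s => [|n IH] s ms.
  have [x _] := path_inhabited B.
  by rewrite /height big_ord0 mul1r (sum_vertex0 _ (pvertex x 0)) -ms cylinder0.
rewrite (IH (fun w => \sum_(e | esrc e == w) s (erng e))).
  by rewrite sum_edges mulrA heightS.
move=> x; rewrite -sumEFin -(@measure_cylinder_split _ _ _ m x (fun v => (s v)%:E))//.
Qed.

(** For an invariant measure, the mass of the set of paths through [v]. *)
Definition level_mass mu n (v : vertex B n) : R := height n * vertex_mass mu v.

Lemma level_mass_ge0 mu n (v : vertex B n) : 0 <= level_mass mu v.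
Proof. by rewrite mulr_ge0 ?vertex_mass_ge0// ltW// height_gt0. Qed.

Lemma sum_level_mass mu n : invariant mu -> \sum_(v : vertex B n) level_mass mu v = 1.
Proof.
move=> inv; rewrite -mulr_sumr; apply: EFin_inj.
rewrite -(@measure_level mu n); last by move=> x; exact: cylinder_mass.
exact: probability_setT.
Qed.

Lemma level_mass_le1 mu n (v : vertex B n) : invariant mu -> level_mass mu v <= 1.
Proof.
move=> inv; rewrite -(sum_level_mass n inv) (bigD1 v)//= lerDl.
by apply: sumr_ge0 => w _; exact: level_mass_ge0.
Qed.

Lemma level_mass_split mu n (w : vertex B n) : invariant mu ->
  level_mass mu w =
  \sum_(v : vertex B n.+1) (incidence v w)%:R / (r n)%:R * level_mass mu v.
Proof.
move=> inv; have r0 : (r n)%:R != 0 :> R by rewrite pnatr_eq0 -lt0n row_sum_gt0.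
rewrite {1}/level_mass vertex_mass_split// (partition_big (@erng B n) xpredT)//=.
rewrite mulr_sumr; apply: eq_bigr => v _.
rewrite /level_mass heightS (eq_bigr (fun=> vertex_mass mu v)); last first.
  by move=> e /andP[_ /eqP ->].
rewrite big_const_seq iter_addr_0 -mulr_natl /incidence.
rewrite (_ : count _ _ = #|[pred e : edge B n | (esrc e == w) && (erng e == v)]|).
  by field.
by rewrite -sum1_card -sum1_count.
Qed.

End levels.

(** * Paths that follow a sequence of vertices *)

Lemma sum_edge_incidence (R : pzSemiRingType) (B : bratteli) n
    (u : vertex B n) (v : vertex B n.+1) :
  (\sum_(e | esrc e == u) (erng e == v)%:R = (incidence v u)%:R :> R)%R.
Proof.
rewrite -natr_sum /incidence -sum1_card; congr (_%:R)%R.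
rewrite [LHS]big_mkcond [RHS]big_mkcond/=; apply: eq_bigr => e _.
by rewrite inE; do 2!case: eqP.
Qed.

Section follow.
Local Open Scope ring_scope.
Variables (R : realType) (B : bratteli) (r : nat -> nat).
Hypothesis rowsum : forall n (v : vertex B n.+1),
  (\sum_(w : vertex B n) incidence v w = r n)%N.
Variable w : forall n, vertex B n.
Implicit Types (x y z : path_space B) (mu nu : probability (borel_path B) R).

Definition follows n k : set (path_space B) :=
  [set y | forall i, (n <= i <= n + k)%N -> pvertex y i = w i].

Definition follows_from n : set (path_space B) :=
  [set y | forall i, (n <= i)%N -> pvertex y i = w i].

(** The probability to go from [w n.+1] to [w n], for the walk that goes down the
    diagram along a uniformly chosen incoming edge. *)
Definition share n : R := (incidence (w n.+1) (w n))%:R / (r n)%:R.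

Let r_gt0 n : 0 < (r n)%:R :> R.
Proof. by rewrite ltr0n; exact: row_sum_gt0 rowsum n. Qed.

Lemma share_ge0 n : 0 <= share n.
Proof. by rewrite divr_ge0. Qed.

Lemma share_le1 n : share n <= 1.
Proof.
rewrite ler_pdivrMr// mul1r ler_nat -(rowsum (w n.+1)).
by rewrite (bigD1 (w n))//= leq_addr.
Qed.

Lemma share_prod_ge0 n m : 0 <= \prod_(n <= j < m) share j.
Proof. by apply: prodr_ge0 => j _; exact: share_ge0. Qed.

Lemma share_prod_le1 n m : \prod_(n <= j < m) share j <= 1.
Proof. by apply: prodr_ile1 => j _; rewrite share_ge0 share_le1. Qed.

Lemma measurable_follows n k : measurable (follows n k : set (borel_path B)).
Proof.
apply: (@measurable_determined _ (n + k)) => x y xy fx i ik.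
by rewrite (cylinder_pvertex xy) ?fx//; case/andP: ik.
Qed.

Lemma follows_fromE n : follows_from n = \bigcap_k follows n k.
Proof.
apply/seteqP; split=> y yw; first by move=> k _ i /andP[ni _]; exact: yw.
by move=> i ni; apply: (yw (i - n)%N) => //; rewrite ni subnKC/=.
Qed.

Lemma measurable_follows_from n : measurable (follows_from n : set (borel_path B)).
Proof.
rewrite follows_fromE; apply: bigcapT_measurable => k; exact: measurable_follows.
Qed.

Lemma odometer_pathsE : odometer_paths w = follows_from 0.
Proof. by apply/seteqP; split=> y yw i => [_|]; exact: yw. Qed.

(** The first edge of the part to be followed runs over the edges from [w n] to
    [w n.+1], whence the induction on [k] for all cylinders at once. *)
Lemma follows_cylinder_mass mu x n k : invariant mu ->
  mu (cylinder x n `&` follows n k) =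
  ((pvertex x n == w n)%:R * (\prod_(n <= j < n + k) (incidence (w j.+1) (w j))%:R
     * vertex_mass mu (w (n + k))))%:E.
Proof.
move=> inv; elim: k n x => [|k IH] n x.
  rewrite addn0 big_geq// mul1r; case: eqP => [xn|xn].
    rewrite mul1r -{1}xn -cylinder_mass// setIidl// => y xy i.
    rewrite addn0 -eqn_leq => /eqP <-; by rewrite (cylinder_pvertex xy).
  rewrite mul0r (_ : _ `&` _ = set0) ?measure0//.
  apply/seteqP; split=> // y [xy yw]; apply: xn.
  by rewrite -(cylinder_pvertex xy (leqnn n)) yw// addn0 leqnn.
case: eqP => [xn|xn]; last first.
  rewrite mul0r (_ : _ `&` _ = set0) ?measure0//.
  apply/seteqP; split=> // y [xy yw]; apply: xn.
  by rewrite -(cylinder_pvertex xy (leqnn n)) yw// leqnn leq_addr.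
pose m : {measure set (borel_path B) -> \bar R} :=
  mrestr mu (measurable_follows n k.+1).
rewrite -[LHS]/(m (cylinder x n)) mul1r.
rewrite (@measure_cylinder_split _ _ n m x (fun v => ((v == w n.+1)%:R *
   (\prod_(n.+1 <= j < n.+1 + k) (incidence (w j.+1) (w j))%:R
     * vertex_mass mu (w (n.+1 + k))))%:E)).
  rewrite sumEFin -mulr_suml; congr EFin.
  rewrite (addnS n k) -(addSn n k) [in RHS](@big_ltn _ _ _ n) ?ltnS ?leq_addr//.
  rewrite -!mulrA; congr (_ * _).
  by rewrite xn sum_edge_incidence.
move=> y xy; rewrite -IH -[LHS]/(mu (cylinder y n.+1 `&` follows n k.+1)).
congr (mu _); apply/seteqP; split=> z [yz zw]; split=> // i /andP[ni ik].
  by apply: zw; rewrite (ltnW ni) addnS.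
move: ni; rewrite leq_eqVlt => /predU1P[<-|ni]; last first.
  by apply: zw; rewrite ni addSnnS.
by rewrite (cylinder_pvertex yz)// (cylinder_pvertex xy).
Qed.

Lemma follows_mass mu n k : invariant mu ->
  mu (follows n k) = (\prod_(n <= j < n + k) share j
                      * level_mass r mu (w (n + k)))%:E.
Proof.
move=> inv; pose m : {measure set (borel_path B) -> \bar R} :=
  mrestr mu (measurable_follows n k).
transitivity (m setT); first by rewrite -[RHS]/(mu (setT `&` _)) setTI.
rewrite (measure_level rowsum (n := n) (s := fun v => ((v == w n)%:R *
   (\prod_(n <= j < n + k) (incidence (w j.+1) (w j))%:R
     * vertex_mass mu (w (n + k)))))); last first.
  by move=> x; rewrite -follows_cylinder_mass.
congr EFin; rewrite -mulr_suml (bigD1 (w n))//= eqxx big1 ?addr0 ?mul1r; last first.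
  by move=> v /negbTE ->.
have rN0 : \prod_(n <= j < n + k) (r j)%:R != 0 :> R.
  by rewrite prodf_seq_neq0; apply/allP => j _; rewrite gt_eqF.
rewrite /share prodf_div /level_mass.
have -> : height R r (n + k) = height R r n * \prod_(n <= j < n + k) (r j)%:R.
  by rewrite /height -!(big_mkord xpredT (fun j => (r j)%:R)) -big_cat_nat ?leq_addr.
by field.
Qed.

Lemma odometer_paths_le_share mu n : invariant mu ->
  (mu (odometer_paths w) <= (\prod_(0 <= j < n) share j)%:E)%E.
Proof.
move=> inv; rewrite odometer_pathsE follows_fromE.
apply: (@le_trans _ _ (mu (follows 0 n))).
  apply: le_measure; rewrite ?inE.
  - by rewrite -follows_fromE; exact: measurable_follows_from.
  - exact: measurable_follows.
  - by move=> y; apply.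
rewrite follows_mass// add0n lee_fin ler_piMr//; first exact: share_prod_ge0.
exact: level_mass_le1.
Qed.

Lemma follows_cvg mu n : mu (follows n k) @[k --> \oo] --> mu (follows_from n).
Proof.
rewrite follows_fromE; apply: nonincreasing_cvg_mu.
- by rewrite (le_lt_trans (probability_le1 _ _)) ?ltry//; exact: measurable_follows.
- by move=> k; exact: measurable_follows.
- by rewrite -follows_fromE; exact: measurable_follows_from.
- move=> k l kl; rewrite subsetEset => y yw i /andP[ni il]; apply: yw.
  by rewrite ni (leq_trans il)// leq_add2l.
Qed.

Lemma follows_from_le_level_mass mu n k : invariant mu ->
  (mu (follows_from n) <= (level_mass r mu (w (n + k)))%:E)%E.
Proof.
move=> inv.
apply: (@le_trans _ _ (mu (follows n k))).
  apply: le_measure; rewrite ?inE.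
  - exact: measurable_follows_from.
  - exact: measurable_follows.
  - by move=> y yw i /andP[ni _]; exact: yw.
rewrite follows_mass// lee_fin ler_piMl ?share_prod_le1// level_mass_ge0//.
Qed.

Lemma odometer_path_exists : odometer w -> odometer_paths w !=set0.
Proof.
move=> odo; have [x xP] := greedy_path (fun n (e : edge B n) => erng e = w n.+1).
exists x; elim=> [|n IH]; first exact: vertex0_eq.
rewrite -erng_pedge; apply: xP.
have /card_gt0P[e] := odo n; rewrite inE => /andP[/eqP es /eqP er].
by exists e; rewrite ?IH.
Qed.

Lemma saturationE : odometer w -> odometer_saturation w = \bigcup_n follows_from n.
Proof.
move=> odo; apply/seteqP; split=> x.
  move=> [y yw [n xy]]; exists n => // i ni.
  by rewrite -(yw i) /pvertex xy.
move=> [n _ xw]; have [z zw] := odometer_path_exists odo.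
have zx : pvertex z n = pvertex x n by rewrite zw xw.
exists (splice z n x); last by exists n => i ni; rewrite splice_ge.
move=> i; have [ni|ni] := leqP n i; first by rewrite pvertex_splice// xw.
by rewrite (cylinder_pvertex (splice_cylinder zx) (ltnW ni)).
Qed.

Lemma measurable_saturation : odometer w ->
  measurable (odometer_saturation w : set (borel_path B)).
Proof.
move=> odo; rewrite saturationE//; apply: bigcupT_measurable => n.
exact: measurable_follows_from.
Qed.

Lemma measurable_odometer_paths :
  measurable (odometer_paths w : set (borel_path B)).
Proof. by rewrite odometer_pathsE; exact: measurable_follows_from. Qed.

Lemma saturation_tail x y : tail_equiv x y ->
  odometer_saturation w x -> odometer_saturation w y.
Proof.
move=> [n xy] [z zw [m xz]]; exists z => //; exists (maxn m n) => i.
by rewrite geq_max => /andP[mi ni]; rewrite -xy// xz.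
Qed.

(** The tail class of the odometer is covered by countably many images of
    parts of its path set under prefix changes. *)
Lemma odometer_paths_gt0 mu : odometer w -> invariant mu ->
  (0 < mu (odometer_saturation w))%E -> (0 < mu (odometer_paths w))%E.
Proof.
move=> odo inv; rewrite !lt0e !measure_ge0 !andbT; apply: contra => /eqP X0.
have [z zw] := odometer_path_exists odo.
have tail0 n : mu (follows_from n) = 0%E.
  pose m : {measure set (borel_path B) -> \bar R} :=
    mrestr mu (measurable_follows_from n).
  transitivity (m setT); first by rewrite -[RHS]/(mu (setT `&` _)) setTI.
  rewrite (measure_level rowsum (n := n) (s := fun=> 0)).
    by rewrite big1// mulr0.
  move=> x; rewrite -[LHS]/(mu (cylinder x n `&` follows_from n)).
  have [xn|xn] := eqVneq (pvertex x n) (w n); last first.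
    rewrite (_ : _ `&` _ = set0) ?measure0//; apply/seteqP; split=> // y [xy yw].
    by move/eqP: xn; apply; rewrite -(cylinder_pvertex xy (leqnn n)) yw.
  rewrite setIC (@invariant_tail_set _ _ mu n _ x z) ?zw//; first last.
  - by move=> y y' yy' yw i ni; rewrite -(yw i) // /pvertex yy'.
  - exact: measurable_follows_from.
  apply/eqP; rewrite -measure_le0; have <- : mu (odometer_paths w) = 0%E := X0.
  apply: le_measure; rewrite ?inE.
  - apply: measurableI; last exact: cylinder_measurable.
    exact: measurable_follows_from.
  - exact: measurable_odometer_paths.
  - move=> y [yw zy] i; have [ni|ni] := leqP n i; first exact: yw.
    by rewrite (cylinder_pvertex zy (ltnW ni)).
rewrite saturationE//; apply/eqP/measure_negligible.
  by apply: bigcupT_measurable => n; exact: measurable_follows_from.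
apply: negligible_bigcup => n; apply/negligibleP; last exact: tail0.
exact: measurable_follows_from.
Qed.

End follow.

(** * Extensions from odometers *)

Section extension.
Local Open Scope ring_scope.
Variables (R : realType) (B : bratteli) (r : nat -> nat).
Hypothesis rowsum : forall n (v : vertex B n.+1),
  (\sum_(w : vertex B n) incidence v w = r n)%N.
Variable w : forall n, vertex B n.
Implicit Types (x y z : path_space B) (mu nu : probability (borel_path B) R).

(** An invariant measure carried by the tail class of an odometer charges the
    odometer itself, and its normalized restriction is the odometer measure. *)
Lemma full_saturation_extends mu : odometer w -> invariant mu ->
  mu (odometer_saturation w) = 1%E -> extends_from_odometer w mu.
Proof.
move=> odo inv sat1.
have Xpos : (0 < mu (odometer_paths w))%E.
  by apply: (odometer_paths_gt0 rowsum) => //; rewrite sat1 lte01.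
have mX := @measurable_odometer_paths B w.
have Xfin : mu (odometer_paths w) \is a fin_num by exact: fin_num_measure.
pose c := fine (mu (odometer_paths w)).
have c0 : 0 < c by rewrite fine_gt0// Xpos ltey_eq Xfin.
have cE : mu (odometer_paths w) = c%:E by rewrite fineK.
have ci0 : 0 <= c^-1 by rewrite invr_ge0 ltW.
pose m : {measure set (borel_path B) -> \bar R} := mrestr mu mX.
have mT : m setT = c%:E by rewrite -cE -[LHS]/(mu (setT `&` _)) setTI.
have [||mubar] := @normalized_probability _ _ _ m; rewrite ?mT ?ltry ?lte_fin//= => barE.
pose muhat : {measure set (borel_path B) -> \bar R} := mscale (NngNum ci0) mu.
have hatE A : muhat A = (c^-1%:E * mu A)%E by [].
have {}barE A : mubar A = (mu (A `&` odometer_paths w) * c^-1%:E)%E by exact: barE.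
exists mubar, muhat; split.
- split; first by rewrite barE setIid cE -EFinM divff// gt_eqF.
  move=> x y n xw yw; rewrite !barE -!setIA !setIid.
  have XE z : odometer_paths w z -> cylinder z n `&` odometer_paths w =
      follows_from w n `&` cylinder z n.
    move=> zw; apply/seteqP; split=> u; first by move=> [zu uw]; split=> // i _; exact: uw.
    move=> [uw zu]; split=> // i; have [ni|ni] := leqP n i; first exact: uw.
    by rewrite (cylinder_pvertex zu (ltnW ni)).
  congr (_ * _)%E; rewrite !XE//; apply: invariant_tail_set => //.
  - exact: measurable_follows_from.
  - by move=> u u' uu' uw i ni; rewrite -(uw i) // /pvertex uu'.
  - by rewrite xw yw.
- split.
  + move=> x y n A xy mA Ax; rewrite !hatE; congr (_ * _)%E.
    exact: (invariant_holonomy inv xy mA Ax).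
  + by move=> A mA AX; rewrite hatE barE setIidl// muleC.
  + have satC : mu (~` odometer_saturation w) = 0%E.
      rewrite probability_setC; last exact: measurable_saturation.
      by rewrite [X in (_ - X)%E]sat1 subee.
    by rewrite hatE [X in (_ * X)%E]satC mule0.
- exists c => // A mA; rewrite hatE muleA -EFinM divff ?gt_eqF// mul1e//.
Qed.

Lemma extends_odometer_paths_gt0 mu :
  extends_from_odometer w mu -> (0 < mu (odometer_paths w))%E.
Proof.
move=> [mubar [muhat [[bar1 _] [_ hatX _] [c c0 muE]]]].
have mX := @measurable_odometer_paths B w.
by rewrite muE// hatX// bar1 mule1 lte_fin.
Qed.

End extension.

Section limit.
Import numFieldNormedType.Exports.

(** Compactness: along an ultrafilter every bounded sequence converges. *)
Lemma ultra_cvg_bounded (R : realType) (T : Type) (G : set_system T)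
    (f : T -> R) (a b : R) : UltraFilter G ->
  G (f @^-1` [set` `[a, b]%R]) -> exists l : R, f x @[x --> G] --> l.
Proof.
move=> GU Gab; have GF : ProperFilter G by exact: ultra_proper.
have [l [_ lcl]] := @segment_compact R a b (f x @[x --> G]) (fmap_proper_filter f GF) Gab.
exists l => V lV; have [//|GV] := in_ultra_setVsetC (f @^-1` V) GU.
have [t [tV /= Vt]] := lcl (~` V) V GV lV.
by case: (tV Vt).
Qed.

End limit.

Section existence.
Import numFieldNormedType.Exports.
Local Open Scope ring_scope.
Variables (R : realType) (B : bratteli) (r : nat -> nat).
Hypothesis rowsum : forall n (v : vertex B n.+1),
  (\sum_(w : vertex B n) incidence v w = r n)%N.
Variable u : forall n, vertex B n.

(** The number of paths of length [k] from [w], at level [n], to [u (n + k)]. *)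
Fixpoint path_count k n (w : vertex B n) : R :=
  if k is k'.+1 then \sum_(e | esrc e == w) path_count k' (erng e)
  else (w == u n)%:R.

Lemma path_count_ge0 k n (w : vertex B n) : 0 <= path_count k w.
Proof. by elim: k n w => [|k IH] n w //=; apply: sumr_ge0 => e _; exact: IH. Qed.

Lemma sum_path_count k n :
  height R r n * \sum_(w : vertex B n) path_count k w = height R r (n + k).
Proof.
elim: k n => [|k IH] n /=.
  rewrite addn0 (bigD1 (u n))//= eqxx big1 ?addr0 ?mulr1// => w.
  by move=> /negbTE ->.
by rewrite (sum_edges rowsum (path_count k (n:=n.+1))) mulrA -heightS IH addnS.
Qed.

(** Only the paths that stay on [u] are kept. *)
Lemma path_count_share k n :
  height R r n * path_count k (u n) >=
  height R r (n + k) * \prod_(n <= j < n + k) share R r u j.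
Proof.
elim: k n => [|k IH] n /=; first by rewrite addn0 big_geq// eqxx.
have r0 : (r n)%:R != 0 :> R by rewrite pnatr_eq0 -lt0n (row_sum_gt0 rowsum).
rewrite addnS -addSn big_ltn ?ltnS ?leq_addr//.
rewrite mulrCA; apply: le_trans (ler_wpM2l (share_ge0 R r u n) (IH n.+1)) _.
rewrite heightS /share mulrA.
rewrite [X in X * _ <= _](_ : _ = height R r n * (incidence (u n.+1) (u n))%:R).
  rewrite -mulrA ler_wpM2l ?(ltW (height_gt0 R rowsum n))//.
  rewrite -sum_edge_incidence mulr_suml ler_sum// => e _.
  by case: eqP => [->|_]; rewrite ?mul1r// mul0r path_count_ge0.
by field.
Qed.

(** Normalized path counts to far away vertices of [u] are almost harmonic, and
    have a limit along an ultrafilter. *)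
Lemma limit_invariant : exists2 mu : probability (borel_path B) R,
  invariant mu & forall n c,
    (forall k, c <= \prod_(n <= j < n + k) share R r u j) ->
    c <= level_mass r mu (u n).
Proof.
have hpos n := height_gt0 R rowsum n.
(* Only [n <= N] matters: for larger [n] the truncated difference is 0. *)
pose P N n (w : vertex B n) : R := path_count (N - n) w / height R r N.
have P01 N n (w : vertex B n) : (n <= N)%N ->
    0 <= height R r n * P N n w <= 1.
  move=> nN; rewrite mulr_ge0 ?divr_ge0 ?path_count_ge0 ?(ltW (hpos _))//=.
  rewrite mulrA ler_pdivrMr// mul1r.
  rewrite (_ : height R r N = height R r (n + (N - n))); last by rewrite subnKC.
  rewrite -sum_path_count ler_wpM2l ?(ltW (hpos _))// (bigD1 w)//= lerDl.
  by apply: sumr_ge0 => v _; exact: path_count_ge0.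
have [G [GU Goo]] := ultraFilterLemma (F := \oo) _.
have GF : ProperFilter G by exact: ultra_proper.
have Gnear (Q : set nat) n : (forall N, (n <= N)%N -> Q N) -> G Q.
  by move=> h; apply: Goo; exists n.
have cvgP n (w : vertex B n) : exists l : R, P N n w @[N --> G] --> l.
  apply: (@ultra_cvg_bounded _ _ _ _ 0 (height R r n)^-1) => //.
  apply: (Gnear _ n) => N nN /=; rewrite in_itv/=.
  have /andP[p0 p1] := P01 N n w nN.
  rewrite -(pmulr_rge0 _ (hpos n)) p0/=.
  by rewrite -(ler_pM2l (hpos n)) divff// gt_eqF.
pose p n (w : vertex B n) := projT1 (cid (cvgP n w)).
have pP n (w : vertex B n) : P N n w @[N --> G] --> p n w.
  exact: (projT2 (cid (cvgP n w))).
have pE n (w : vertex B n) (l : R) (Q : nat -> R) :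
    (Q N @[N --> G] --> l) -> (forall N, (n < N)%N -> P N n w = Q N) -> p n w = l.
  move=> Ql PQ; apply: (cvg_unique _ (pP n w)) => //.
  apply: cvg_trans Ql; apply: near_eq_cvg.
  by apply: (Gnear _ n.+1) => N nN /=; rewrite PQ.
have [||| mu muE] := @harmonic_probability R B p.
- move=> v; apply: (pE _ _ _ (cst 1)); first exact: cvg_cst.
  move=> N _; rewrite /P subn0.
  rewrite -(sum_vertex0 (path_count N (n:=0)) v).
  have := sum_path_count N 0; rewrite /height big_ord0 mul1r add0n => ->.
  by rewrite divff// gt_eqF// -/(height R r N).
- move=> n v; apply: (ler_cvg_to (cvg_cst 0) (pP n v)).
  by apply: (Gnear _ n) => N nN /=; rewrite divr_ge0 ?path_count_ge0// ltW.
- move=> n v.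
  apply: (pE _ _ _ (fun N => \sum_(e | esrc e == v) P N n.+1 (erng e))).
    by apply: cvg_big => [|e _]; [exact: add_continuous | exact: pP].
  move=> N nN; rewrite /P -mulr_suml.
  by rewrite -(subnSK nN).
exists mu.
  by move=> x y n xy; rewrite !muE xy.
move=> n c cle.
have -> : level_mass r mu (u n) = height R r n * p n (u n).
  rewrite /level_mass; congr (_ * _); have [x xu] := path_through (u n).
  apply: EFin_inj; rewrite -{1}xu -cylinder_mass ?muE ?xu//.
  by move=> y z m yz; rewrite !muE yz.
have hP : height R r n * P N n (u n) @[N --> G] --> height R r n * p n (u n).
  by apply: cvgM; [exact: cvg_cst | exact: pP].
apply: (ler_cvg_to (cvg_cst c) hP).
apply: (Gnear _ n) => N nN /=; rewrite /P mulrA ler_pdivlMr//.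
apply: le_trans (path_count_share (N - n) n).
by rewrite mulrC; have := cle (N - n)%N; rewrite subnKC// => h; rewrite ler_pM2l.
Qed.

End existence.

(** * Series and infinite products *)

Section series.
Local Open Scope ring_scope.
Variable R : realType.
Implicit Types s f : nat -> R.

(** Union bound for the complements of independent events. *)
Lemma prod_ge_sum_defect s m n : (forall k, 0 <= s k <= 1) ->
  1 - \sum_(m <= k < n) (1 - s k) <= \prod_(m <= k < n) s k.
Proof.
move=> s01; have [nm|mn] := leqP n m; first by rewrite !big_geq// subr0.
elim: n mn => // n IH; rewrite ltnS leq_eqVlt => /predU1P[->|mn].
  by rewrite !big_nat1 subKr.
rewrite !big_nat_recr ?(ltnW mn)//=; move: (IH mn).
have : 0 <= \sum_(m <= k < n) (1 - s k).
  by apply: sumr_ge0 => k _; rewrite subr_ge0; case/andP: (s01 k).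
case/andP: (s01 n); move: (\sum_(_ <= _ < _) _) (\prod_(_ <= _ < _) _) => S P.
nra.
Qed.

(** A substitute for [1 - t <= exp (- t)]: divergence of the sum of the defects
    makes the product vanish. *)
Lemma prod_mul_sum_defect_le1 s m n : (forall k, 0 <= s k <= 1) ->
  (\prod_(m <= k < n) s k) * (1 + \sum_(m <= k < n) (1 - s k)) <= 1.
Proof.
move=> s01; have [nm|mn] := leqP n m; first by rewrite !big_geq// addr0 mulr1.
elim: n mn => // n IH; rewrite ltnS leq_eqVlt => /predU1P[->|mn].
  by rewrite !big_nat1; case/andP: (s01 n); nra.
rewrite !big_nat_recr ?(ltnW mn)//=; apply: le_trans (IH mn).
have S0 : 0 <= \sum_(m <= k < n) (1 - s k).
  by apply: sumr_ge0 => k _; rewrite subr_ge0; case/andP: (s01 k).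
have P0 : 0 <= \prod_(m <= k < n) s k.
  by apply: prodr_ge0 => k _; case/andP: (s01 k).
rewrite -mulrA ler_wpM2l//; move: S0; case/andP: (s01 n).
move: (\sum_(_ <= _ < _) _) => S; nra.
Qed.

Lemma nneseries_bounded f m (A : R) : (forall k, 0 <= f k) ->
  (forall n, \sum_(m <= k < n) f k <= A) ->
  (\sum_(1 <= k <oo) (f k)%:E < +oo)%E.
Proof.
move=> f0 fA.
apply: (@le_lt_trans _ _ (\sum_(1 <= k < m) f k + A)%:E); last exact: ltry.
apply: lime_le; first by apply: is_cvg_nneseries => n _ _; rewrite lee_fin.
apply: nearW => n; rewrite sumEFin lee_fin.
have [nm|mn] := leqP n m.
  apply: (@le_trans _ _ (\sum_(1 <= k < m) f k)); last first.
    by rewrite lerDl; apply: le_trans (fA m); rewrite big_geq.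
  have [n1|n1] := leqP 1 n; last by rewrite big_geq ?sumr_ge0// ltnW.
  by rewrite (@big_cat_nat _ _ _ n 1 m)//= lerDl sumr_ge0.
have [m1|m1] := leqP 1 m.
  by rewrite (@big_cat_nat _ _ _ m 1 n) ?(ltnW mn)//= lerD2l.
move: m1; rewrite ltnS leqn0 => /eqP m0; move: mn fA; rewrite m0 => n0 fA.
rewrite [X in _ <= X + _]big_geq// add0r; apply: le_trans (fA n).
by rewrite [leRHS]big_ltn// lerDr.
Qed.

Lemma nneseries_small_tails f : (forall k, 0 <= f k) ->
  (\sum_(1 <= k <oo) (f k)%:E < +oo)%E ->
  forall e, 0 < e -> exists n, forall m k, (n <= m)%N ->
    \sum_(m <= j < m + k) f j <= e.
Proof.
move=> f0 fin e e0; set S := (\sum_(1 <= k <oo) (f k)%:E)%E in fin.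
have partial n : ((\sum_(1 <= k < n) f k)%:E <= S)%E.
  rewrite -sumEFin; apply: nneseries_lim_ge => k _ _; by rewrite lee_fin.
have S0 : (0 <= S)%E by apply: le_trans (partial 1%N); rewrite big_geq.
have SE : S = (fine S)%:E by rewrite fineK// ge0_fin_numE.
have [n [n1 nS]] : exists n, (1 <= n)%N /\ fine S - e < \sum_(1 <= k < n) f k.
  apply: contrapT => H.
  have /negP : ~~ (fine S <= fine S - e) by rewrite -ltNge ltrBlDr ltrDl.
  apply; rewrite -lee_fin -SE.
  apply: lime_le; first by apply: is_cvg_nneseries => n _ _; rewrite lee_fin.
  exists 1%N => // n n1; rewrite /= sumEFin lee_fin leNgt; apply/negP => nS.
  by apply: H; exists n.
exists n => m k nm; have := partial (m + k)%N; rewrite SE lee_fin.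
rewrite (@big_cat_nat _ _ _ m 1 (m + k))/= ?leq_addr ?(leq_trans n1)//.
rewrite (@big_cat_nat _ _ _ n 1 m)//=.
have : 0 <= \sum_(n <= j < m) f j by exact: sumr_ge0.
lra.
Qed.

Lemma eq_eseries_gt0 (f g : nat -> \bar R) :
  (forall k, (0 < k)%N -> f k = g k) ->
  (\sum_(1 <= k <oo) f k = \sum_(1 <= k <oo) g k)%E.
Proof.
move=> fg; apply/congr_lim/funext => n.
by apply: eq_big_nat => k /andP[k0 _]; exact: fg.
Qed.

Lemma le_eseries_gt0 (f g : nat -> \bar R) :
  (forall k, (0 < k)%N -> (0 <= f k <= g k)%E) ->
  (\sum_(1 <= k <oo) f k <= \sum_(1 <= k <oo) g k)%E.
Proof.
move=> fg; pose drop0 (h : nat -> \bar R) k := if k is 0 then 0%E else h k.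
rewrite (@eq_eseries_gt0 f (drop0 f)); last by case.
rewrite (@eq_eseries_gt0 g (drop0 g)); last by case.
apply: lee_nneseries => [k k0 _|[|k] _] //=.
  by case: k k0 => // k k0; case/andP: (fg _ k0).
by case/andP: (fg _ (ltn0Sn k)).
Qed.

(** For values in [0, 1] this amounts to the summability of [1 - s], in the form
    that bounds masses from below. *)
Definition tail_products_to_one s := forall e : R, 0 < e ->
  exists n, forall m k, (n <= m)%N -> 1 - e <= \prod_(m <= j < m + k) s j.

Lemma summable_defect_tail_products s : (forall k, 0 <= s k <= 1) ->
  (\sum_(1 <= k <oo) (1 - s k)%:E < +oo)%E -> tail_products_to_one s.
Proof.
move=> s01 fin e e0; have f0 k : 0 <= 1 - s k.
  by rewrite subr_ge0; case/andP: (s01 k).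
have [n nP] := nneseries_small_tails f0 fin e0.
exists n => m k nm; apply: le_trans (prod_ge_sum_defect _ _ s01).
by rewrite lerD2l lerN2 nP.
Qed.

Lemma prod_bounded_below_summable s m (c : R) : (forall k, 0 <= s k <= 1) ->
  0 < c -> (forall n, c <= \prod_(m <= k < n) s k) ->
  (\sum_(1 <= k <oo) (1 - s k)%:E < +oo)%E.
Proof.
move=> s01 c0 cP; apply: (@nneseries_bounded _ m c^-1).
  by move=> k; rewrite subr_ge0; case/andP: (s01 k).
move=> n; have := prod_mul_sum_defect_le1 m n s01.
have S0 : 0 <= \sum_(m <= k < n) (1 - s k).
  by apply: sumr_ge0 => k _; rewrite subr_ge0; case/andP: (s01 k).
move=> PS; rewrite -[leRHS]mul1r ler_pdivlMr//.
by apply: le_trans PS; move: (cP n); nra.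
Qed.

End series.

(** * Measures carried by the tail class of an odometer *)

Section carried.
Local Open Scope ring_scope.
Variables (R : realType) (B : bratteli) (r : nat -> nat).
Hypothesis rowsum : forall n (v : vertex B n.+1),
  (\sum_(w : vertex B n) incidence v w = r n)%N.
Implicit Types (w : forall n, vertex B n) (mu nu : probability (borel_path B) R).

Lemma share01 w k : 0 <= share R r w k <= 1.
Proof. by rewrite share_ge0 share_le1. Qed.

Lemma ge1_of_approx (x : \bar R) :
  (forall e : R, 0 < e -> ((1 - e)%:E <= x)%E) -> (1 <= x)%E.
Proof.
move=> h; apply/lee_subgt0Pr => e e0; rewrite -EFinB; exact: h.
Qed.

Lemma approx_prod (e P Q : R) : 0 <= P -> 0 <= Q ->
  1 - e / 2 <= P -> 1 - e / 2 <= Q -> 1 - e <= P * Q.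
Proof.
move=> P0 Q0 eP eQ; have [t1|t1] := ltP (e / 2) 1; last first.
  by apply: (@le_trans _ _ 0); [lra|exact: mulr_ge0].
apply: (@le_trans _ _ ((1 - e / 2) * (1 - e / 2))).
  by have := sqr_ge0 (e / 2); rewrite expr2; nra.
by apply: ler_pM => //; lra.
Qed.

Lemma approx_convex (e P1 P2 Q1 Q2 : R) : 0 <= P1 -> 0 <= P2 -> 0 <= Q1 -> 0 <= Q2 ->
  1 - e <= P1 -> 1 - e <= P2 -> 1 <= Q1 + Q2 -> 1 - e <= P1 * Q1 + P2 * Q2.
Proof.
move=> P10 P20 Q10 Q20 eP1 eP2 Q12; have [e1|e1] := leP e 1; last first.
  by apply: (@le_trans _ _ 0); [lra|rewrite addr_ge0// mulr_ge0].
apply: (@le_trans _ _ ((1 - e) * (Q1 + Q2))); first by rewrite ler_peMr// subr_ge0.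
by rewrite mulrDr; apply: lerD; exact: ler_wpM2r.
Qed.

(** Paths that stay on [w] from a high level on: they keep almost all of the
    mass of their starting vertex, and that vertex has almost all the mass. *)
Lemma carried_exists w : odometer w -> tail_products_to_one (share R r w) ->
  exists2 mu : probability (borel_path B) R,
    invariant mu & mu (odometer_saturation w) = 1%E.
Proof.
move=> odo ws; have [mu inv muP] := limit_invariant R rowsum w.
exists mu => //; have msat := measurable_saturation odo.
apply/eqP; rewrite eq_le probability_le1//=; apply: ge1_of_approx => e e0.
have [n nP] := ws (e / 2) (divr_gt0 e0 (ltr0n _ 2)).
apply: (@le_trans _ _ (mu (follows_from w n))); last first.
  apply: le_measure; rewrite ?inE//; first exact: measurable_follows_from.
  by rewrite saturationE// => y yw; exists n.
apply: (cvge_ge _ (@follows_cvg R B w mu n)); apply: nearW => k.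
rewrite (follows_mass rowsum)// lee_fin.
apply: approx_prod; [exact: share_prod_ge0|exact: level_mass_ge0| exact: nP|].
by apply: muP => l; apply: nP; exact: leq_addr.
Qed.

(** At any level the two odometers together have mass 1, and from a high level on
    each keeps almost all of its mass. *)
Lemma carried_cover u v mu : odometer u -> odometer v ->
  (forall n (x : vertex B n.+1), x = u n.+1 \/ x = v n.+1) ->
  tail_products_to_one (share R r u) -> tail_products_to_one (share R r v) ->
  invariant mu ->
  (1 <= mu (odometer_saturation u) + mu (odometer_saturation v))%E.
Proof.
move=> odou odov cover us vs inv; apply: ge1_of_approx => e e0.
have [n1 nP1] := us _ e0; have [n2 nP2] := vs _ e0.
pose n := maxn n1 n2.
have sub w : odometer w ->
    (mu (follows_from w n) <= mu (odometer_saturation w))%E.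
  move=> odo; apply: le_measure; rewrite ?inE//.
  - exact: measurable_follows_from.
  - exact: measurable_saturation.
  - by rewrite saturationE// => y yw; exists n.
apply: le_trans (leeD (sub u odou) (sub v odov)).
have cover_mass m : (0 < m)%N ->
    1 <= level_mass r mu (u m) + level_mass r mu (v m).
  case: m => // m _; rewrite -(sum_level_mass rowsum m.+1 inv).
  have Q0 := level_mass_ge0 rowsum mu.
  have [uv|uv] := eqVneq (u m.+1) (v m.+1).
    rewrite (bigD1 (u m.+1))//= big1 ?addr0 ?lerDl//.
    by move=> x /negP; case: (cover _ x) => ->; rewrite ?uv eqxx.
  rewrite (bigD1 (u m.+1))//= (bigD1 (v m.+1)) 1?eq_sym//=.
  rewrite [X in _ + (_ + X)]big1 ?addr0// => x /andP[/negP xu /negP xv].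
  by case: (cover _ x) => xE; exfalso; [apply: xu|apply: xv]; rewrite xE.
have fin w : mu (follows_from w n) \is a fin_num.
  by apply: fin_num_measure; exact: measurable_follows_from.
apply: (cvge_ge _ (cvgeD _ (@follows_cvg R B u mu n) (@follows_cvg R B v mu n))).
  exists 1%N => // k k0; rewrite /= !(follows_mass rowsum)// -EFinD lee_fin.
  have Pu := nP1 n k (leq_maxl _ _); have Pv := nP2 n k (leq_maxr _ _).
  have S1 := cover_mass (n + k)%N (ltn_addl n k0).
  by apply: approx_convex => //; rewrite ?share_prod_ge0// (level_mass_ge0 rowsum).
by rewrite fin_num_adde_defl.
Qed.

(** The mass of the set of paths of the odometer is a lower bound for all products
    of its shares. *)
Lemma extends_summable_defect w mu : invariant mu -> extends_from_odometer w mu ->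
  (\sum_(1 <= k <oo) (1 - share R r w k)%:E < +oo)%E.
Proof.
move=> inv /extends_odometer_paths_gt0 Xpos.
have Xfin : mu (odometer_paths w) \is a fin_num.
  by apply: fin_num_measure; exact: measurable_odometer_paths.
apply: (@prod_bounded_below_summable _ _ 0 (fine (mu (odometer_paths w)))).
- exact: share01.
- by rewrite fine_gt0// Xpos ltey_eq Xfin.
- move=> n; rewrite -lee_fin fineK//; exact: odometer_paths_le_share.
Qed.

Lemma carried_level_mass w mu : odometer w -> invariant mu ->
  mu (odometer_saturation w) = 1%E -> forall e : R, 0 < e ->
  exists n, forall k, 1 - e <= level_mass r mu (w (n + k)).
Proof.
move=> odo inv sat1 e e0.
have cvg : mu (follows_from w n) @[n --> \oo] --> mu (odometer_saturation w).
  rewrite saturationE//; apply: nondecreasing_cvg_mu.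
  - by move=> n; exact: measurable_follows_from.
  - by rewrite -saturationE//; exact: measurable_saturation.
  - move=> k l kl; rewrite subsetEset => y yw i li; apply: yw.
    exact: leq_trans li.
have [n nP] : exists n, ((1 - e)%:E <= mu (follows_from w n))%E.
  apply: contrapT => H.
  have : (mu (odometer_saturation w) <= (1 - e)%:E)%E.
    apply: (cvge_le _ cvg); apply: nearW => n; rewrite leNgt.
    by apply/negP => /ltW nP; apply: H; exists n.
  rewrite [X in (X <= _)%E]sat1 lee_fin; lra.
exists n => k; rewrite -lee_fin; apply: le_trans nP _; exact: follows_from_le_level_mass.
Qed.

End carried.

(** * Two vertices per level *)

Section two_by_two.
Local Open Scope ring_scope.
Variables (R : realType) (B : bratteli) (lab : forall n, 'I_2 -> vertex B n.+1).
Variables (r0 : nat) (a b c d r : nat -> nat).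
Hypothesis H : two_by_two_equal_row_sum lab r0 a b c d r.
Implicit Types (w : forall n, vertex B n) (mu nu : probability (borel_path B) R).

Lemma ord2P (i : 'I_2) : i = ord0 \/ i = ord_max.
Proof. by case: i => [[|[|//]] ?]; [left|right]; apply: val_inj. Qed.

Lemma lab_cover n (v : vertex B n.+1) : v = lab n ord0 \/ v = lab n ord_max.
Proof.
have [bij _ _ _] := H; have [g _ gK] := bij n.
by rewrite -(gK v); case: (ord2P (g v)) => ->; [left|right].
Qed.

Lemma sum_lab (V : nmodType) n (F : vertex B n.+1 -> V) :
  \sum_v F v = F (lab n ord0) + F (lab n ord_max).
Proof.
have [bij _ _ _] := H; rewrite (reindex (lab n)); last exact: onW_bij.
rewrite !big_ord_recl big_ord0 /= addr0; congr (_ + F (lab n _)); exact: val_inj.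
Qed.

Lemma incidence_lab n i j :
  incidence (lab n.+1 i) (lab n j) = mx2 (a n.+1) (c n.+1) (d n.+1) (b n.+1) i j.
Proof. by have [_ _ /(_ n) <- _] := H; rewrite mxE. Qed.

Lemma row_sums n : (a n.+1 + c n.+1 = r n.+1)%N /\ (d n.+1 + b n.+1 = r n.+1)%N.
Proof. by have [_ _ _] := H. Qed.

(** The edges at the root are counted by [r0]; the value [r 0] is arbitrary. *)
Definition row_total n := if n is 0 then r0 else r n.

Lemma rowsum n (v : vertex B n.+1) :
  (\sum_(w : vertex B n) incidence v w = row_total n)%N.
Proof.
case: n v => [|n] v; rewrite /row_total.
  have [_ h _ _] := H; have [x _] := path_inhabited B.
  by rewrite (big_pred1 (pvertex x 0)) ?h// => w /=; rewrite (vertex0_eq w (pvertex x 0)) eqxx.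
rewrite (sum_lab (V := nat)); have [ac db] := row_sums n.
by case: (lab_cover v) => ->; rewrite !incidence_lab !mxE; [exact: ac|exact: db].
Qed.

Lemma r_gt0 n : (0 < r n.+1)%N.
Proof. exact: (row_sum_gt0 rowsum n.+1). Qed.

(** The determinant of the stochastic matrix [F_n / r_n], and the slope of the
    affine map between the masses of first vertices of consecutive levels. *)
Definition contraction n : R := ((a n)%:R - (d n)%:R) / (r n)%:R.

Lemma norm_contraction n :
  `|contraction n.+1| = `|(a n.+1)%:R - (d n.+1)%:R| / (r n.+1)%:R.
Proof. by rewrite normrM normfV [X in _ / X]ger0_norm. Qed.

Lemma entries_le n : (a n.+1 <= r n.+1)%N /\ (d n.+1 <= r n.+1)%N.
Proof. by have [ac db] := row_sums n; rewrite -{1}ac -db !leq_addr. Qed.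

Lemma contraction_le1 n : `|contraction n.+1| <= 1.
Proof.
have [ar dr] := entries_le n; have r0' : 0 < (r n.+1)%:R :> R by rewrite ltr0n r_gt0.
rewrite norm_contraction ler_pdivrMr// mul1r ler_norml.
move: ar dr; rewrite -!(ler_nat R).
have := ler0n R (a n.+1); have := ler0n R (d n.+1).
by move=> ????; apply/andP; split; lra.
Qed.

Lemma contraction_defect_ge0 n : 0 <= 1 - `|contraction n.+1|.
Proof. by rewrite subr_ge0 contraction_le1. Qed.

Definition first_mass mu n : R := level_mass row_total mu (lab n ord0).

Lemma second_mass mu n : invariant mu ->
  level_mass row_total mu (lab n ord_max) = 1 - first_mass mu n.
Proof.
move=> inv; apply/eqP; rewrite eq_sym subr_eq addrC; apply/eqP.
by rewrite -(sum_level_mass rowsum n.+1 inv) sum_lab.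
Qed.

Lemma first_mass_split mu n : invariant mu ->
  first_mass mu n =
  (d n.+1)%:R / (r n.+1)%:R + contraction n.+1 * first_mass mu n.+1.
Proof.
move=> inv; rewrite /first_mass (level_mass_split rowsum _ inv) sum_lab.
rewrite !incidence_lab !mxE/= second_mass// /contraction /first_mass.
have r0' : (r n.+1)%:R != 0 :> R by rewrite pnatr_eq0 -lt0n r_gt0.
by field.
Qed.

Lemma first_mass_diff mu nu m k : invariant mu -> invariant nu ->
  `|first_mass mu m - first_mass nu m| =
  \prod_(m <= j < m + k) `|contraction j.+1| *
  `|first_mass mu (m + k) - first_mass nu (m + k)|.
Proof.
move=> imu inu; elim: k => [|k IH]; first by rewrite addn0 big_geq// mul1r.
rewrite IH addnS big_nat_recr ?leq_addr//= -mulrA -normrM; congr (_ * `|_|).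
by rewrite (first_mass_split _ imu) (first_mass_split _ inu); ring.
Qed.

Lemma first_mass01 mu n : invariant mu -> 0 <= first_mass mu n <= 1.
Proof.
by move=> inv; rewrite (level_mass_ge0 rowsum)/= (level_mass_le1 rowsum).
Qed.

Lemma same_measure_first_mass mu nu : invariant mu -> invariant nu ->
  (forall n, first_mass mu n = first_mass nu n) -> same_measure mu nu.
Proof.
move=> imu inu E; apply: same_measure_mass => // n v.
have h0 : height R row_total n != 0 by rewrite gt_eqF// (height_gt0 R rowsum).
apply: (mulfI h0).
rewrite -!/(level_mass row_total _ v); case: n v {h0} => [|n] v.
  by rewrite -!(sum_vertex0 _ v) !sum_level_mass//; exact: rowsum.
by case: (lab_cover v) => ->; [exact: E|rewrite !second_mass// E].
Qed.

Lemma sum_diffE : sum_diff R a d r = (\sum_(1 <= k <oo) (1 - `|contraction k|)%:E)%E.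
Proof.
apply: eq_eseries_gt0 => k k0; congr (1 - _)%:E.
by case: k k0 => // k _; rewrite norm_contraction.
Qed.

(** A positive distance at level [m] would bound all products of the slopes from
    below, and the series would converge. *)
Lemma same_measure_of_divergent mu nu : sum_diff R a d r = +oo%E ->
  invariant mu -> invariant nu -> same_measure mu nu.
Proof.
move=> div imu inu; apply: same_measure_first_mass => // m; apply/eqP.
rewrite -subr_eq0 -normr_eq0; apply: contraT => D0.
suff : (sum_diff R a d r < +oo)%E by rewrite div ltxx.
pose s k := if k is 0 then 1 else `|contraction k|.
have s01 k : 0 <= s k <= 1 by case: k => [|k]; rewrite /= ?ler01 ?lexx// normr_ge0 contraction_le1.
have -> : sum_diff R a d r = (\sum_(1 <= k <oo) (1 - s k)%:E)%E.
  by rewrite sum_diffE; apply: eq_eseries_gt0 => -[].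
have D1 : `|first_mass mu m - first_mass nu m| <= 1.
  have /andP[? ?] := first_mass01 m imu; have /andP[? ?] := first_mass01 m inu.
  by rewrite ler_norml; apply/andP; split; lra.
apply: (@prod_bounded_below_summable _ s m.+1 `|first_mass mu m - first_mass nu m|) => //.
  by rewrite lt_neqAle eq_sym D0 normr_ge0.
case=> [|n]; first by rewrite big_geq.
have [nm|mn] := leqP n m; first by rewrite big_geq.
rewrite big_add1/= (first_mass_diff m (n - m) imu inu) subnKC ?(ltnW mn)//.
rewrite ler_piMr//; first by apply: prodr_ge0.
have /andP[? ?] := first_mass01 n imu; have /andP[? ?] := first_mass01 n inu.
by rewrite ler_norml; apply/andP; split; lra.
Qed.

(** Both measures give almost all of their mass to [w n] for large [n], and the
    affine maps between levels do not increase distances. *)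
Lemma same_measure_of_carried w mu nu : odometer w -> invariant mu -> invariant nu ->
  mu (odometer_saturation w) = 1%E -> nu (odometer_saturation w) = 1%E ->
  same_measure mu nu.
Proof.
move=> odo imu inu mu1 nu1; apply: same_measure_first_mass => // m.
apply/eqP; rewrite -subr_eq0 -normr_eq0 eq_le normr_ge0 andbT.
apply/ler_addgt0Pr => e e0; rewrite add0r.
have [n1 nP1] := carried_level_mass rowsum odo imu mu1 e0.
have [n2 nP2] := carried_level_mass rowsum odo inu nu1 e0.
pose N := (n1 + n2)%N.
rewrite (first_mass_diff m N imu inu); apply: le_trans (_ : `|first_mass mu (m + N) - first_mass nu (m + N)| <= e).
  rewrite ler_piMl//; apply: prodr_ile1 => j _.
  by rewrite normr_ge0 contraction_le1.
have : 1 - e <= level_mass row_total mu (w (m + N).+1).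
  by rewrite /N addnCA -addnS nP1.
have : 1 - e <= level_mass row_total nu (w (m + N).+1).
  by rewrite /N addnA addnC -addnS nP2.
have /andP[? ?] := first_mass01 (m + N) imu.
have /andP[? ?] := first_mass01 (m + N) inu.
rewrite ler_norml.
case: (lab_cover (w (m + N).+1)) => ->.
  by rewrite -!/(first_mass _ _) => ? ?; apply/andP; split; lra.
by rewrite !second_mass// => ? ?; apply/andP; split; lra.
Qed.

(** Restricting to a tail-invariant set and normalizing yields an invariant
    measure that is carried by the same odometer, hence the same measure. *)
Lemma carried_ergodic w mu : odometer w -> invariant mu ->
  mu (odometer_saturation w) = 1%E -> ergodic mu.
Proof.
move=> odo inv mu1 A mA tailA.
have [A0|A0] := eqVneq (mu A) 0%E; [by left | right].
pose m : {measure set (borel_path B) -> \bar R} := mrestr mu mA.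
have mE C : m C = mu (C `&` A) by [].
have mT : m setT = mu A by rewrite mE setTI.
have Afin : mu A \is a fin_num by exact: fin_num_measure.
have Apos : (0 < mu A)%E by rewrite lt0e A0 measure_ge0.
have [||P PE] := @normalized_probability _ _ _ m; rewrite ?mT//.
  by rewrite ltey_eq Afin.
rewrite mT in PE.
have invP : invariant P.
  move=> x y n xy; rewrite !PE !mE; congr (_ * _)%E; rewrite ![_ `&` A]setIC.
  apply: invariant_tail_set => // z z' zz'; apply: tailA; by exists n.
have msat := measurable_saturation odo.
have AE : (mu A * (fine (mu A))^-1%:E = 1)%E.
  by rewrite -{1}(fineK Afin) -EFinM divff// fine_eq0.
have P1 : P (odometer_saturation w) = 1%E.
  rewrite PE mE -[RHS]AE; congr (_ * _)%E.
  have satC : mu (~` odometer_saturation w) = 0%E.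
    by rewrite probability_setC// [X in (_ - X)%E]mu1 subee.
  rewrite [in RHS](measureDI mu mA msat) setIC.
  have AC0 : mu (A `\` odometer_saturation w) = 0%E.
    apply: (subset_measure0 _ _ _ satC); last by move=> x [].
    - exact: measurableD.
    - exact: measurableC.
  by rewrite [X in (_ = X + _)%E]AC0 add0e.
have same := same_measure_of_carried odo invP inv P1 mu1.
have muA : mu A = 1%E by rewrite -[LHS](same A mA) PE mE setIid.
by rewrite probability_setC// [X in (_ - X)%E]muA subee.
Qed.

End two_by_two.

(** * Classification by the series *)

Section classification.
Local Open Scope ring_scope.
Variables (R : realType) (B : bratteli) (lab : forall n, 'I_2 -> vertex B n.+1).
Variables (r0 : nat) (a b c d r : nat -> nat).
Hypothesis H : two_by_two_equal_row_sum lab r0 a b c d r.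
Implicit Types (w : forall n, vertex B n) (mu nu : probability (borel_path B) R).

Let rtot := row_total r0 r.
Let total := rowsum H.

Let rpos n : 0 < (r n.+1)%:R :> R.
Proof. by rewrite ltr0n (r_gt0 H). Qed.

Lemma sum_diff_ge0_term n :
  0 <= 1 - `|(a n.+1)%:R - (d n.+1)%:R| / (r n.+1)%:R :> R.
Proof. by rewrite -(norm_contraction R a d r) (contraction_defect_ge0 R H). Qed.

Lemma sum_diff_split n :
  1 - `|(a n.+1)%:R - (d n.+1)%:R| / (r n.+1)%:R =
  (1 - (maxn (a n.+1) (d n.+1))%:R / (r n.+1)%:R)
  + (minn (a n.+1) (d n.+1))%:R / (r n.+1)%:R :> R.
Proof.
have r0' : (r n.+1)%:R != 0 :> R by rewrite gt_eqF.
have [ad|da] := leqP (a n.+1) (d n.+1).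
  by rewrite ler0_norm ?subr_le0 ?ler_nat//; field.
by rewrite ger0_norm ?subr_ge0 ?ler_nat 1?ltnW//; field.
Qed.

Lemma max_term_ge0 n : 0 <= 1 - (maxn (a n.+1) (d n.+1))%:R / (r n.+1)%:R :> R.
Proof.
have [ar dr] := entries_le H n.
by rewrite subr_ge0 ler_pdivrMr// mul1r ler_nat geq_max ar dr.
Qed.

Lemma min_term_ge0 n : 0 <= (minn (a n.+1) (d n.+1))%:R / (r n.+1)%:R :> R.
Proof. by rewrite divr_ge0. Qed.

Lemma sum_diff_max_min : (sum_diff R a d r < +oo)%E <->
  (sum_max R a d r < +oo)%E /\ (sum_min R a d r < +oo)%E.
Proof.
split=> [fin|[fmax fmin]].
  split; apply: le_lt_trans fin; apply: le_eseries_gt0 => -[//|k] _.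
    by rewrite !lee_fin max_term_ge0 sum_diff_split lerDl min_term_ge0.
  by rewrite !lee_fin min_term_ge0 sum_diff_split lerDr max_term_ge0.
apply: (@le_lt_trans _ _ (sum_max R a d r + sum_min R a d r)%E); last first.
  by rewrite lte_add_pinfty.
rewrite /sum_max /sum_min -nneseriesD; first last.
- by case=> // k _ _; rewrite lee_fin min_term_ge0.
- by case=> // k _ _; rewrite lee_fin max_term_ge0.
apply: le_eseries_gt0 => -[//|k] _.
by rewrite lee_fin sum_diff_ge0_term -EFinD sum_diff_split lexx.
Qed.

Lemma sum_diff_infinite : sum_diff R a d r = +oo%E <-> ~ (sum_diff R a d r < +oo)%E.
Proof. by rewrite ltey; split=> [-> /eqP//|/negP/negPn/eqP]. Qed.

(** When the series converges, [F_n / r_n] is close to the identity or to the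
    transposition, according to the sign of [a_n - d_n]; the label follows that
    permutation. *)
Fixpoint main_label (i : 'I_2) n : 'I_2 :=
  if n is m.+1 then
    if (d n <= a n)%N then main_label i m else rev_ord (main_label i m)
  else i.

Definition root : vertex B 0 := pvertex (projT1 (cid (path_inhabited B))) 0.

Definition main_vertex (i : 'I_2) n : vertex B n :=
  match n with 0 => root | m.+1 => lab m (main_label i m) end.

Lemma main_label_rev n : main_label ord_max n = rev_ord (main_label ord0 n).
Proof.
elim: n => [|n /= ->]; first exact: val_inj.
by case: ifP.
Qed.

Lemma main_vertex_cover n (x : vertex B n.+1) :
  x = main_vertex ord0 n.+1 \/ x = main_vertex ord_max n.+1.
Proof.
rewrite /main_vertex main_label_rev.
have r0' : rev_ord ord0 = ord_max :> 'I_2 by exact: val_inj.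
have r1' : rev_ord ord_max = ord0 :> 'I_2 by exact: val_inj.
by case: (ord2P (main_label ord0 n)) => ->; rewrite ?r0' ?r1';
  case: (lab_cover H x); auto.
Qed.

Lemma main_vertex_neq n : main_vertex ord0 n.+1 != main_vertex ord_max n.+1.
Proof.
have [bij _ _ _] := H; rewrite /main_vertex main_label_rev.
rewrite (inj_eq (bij_inj (bij n))).
by case: (ord2P (main_label ord0 n)) => ->.
Qed.

Lemma column_gt0 n : (0 < a n.+1 + d n.+1)%N /\ (0 < c n.+1 + b n.+1)%N.
Proof.
have out j : exists i, (0 < incidence (lab n.+1 i) (lab n j))%N.
  have [e es] := esrc_surj (lab n j).
  have inc : (0 < incidence (erng e) (lab n j))%N.
    by apply/card_gt0P; exists e; rewrite inE es !eqxx.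
  by case: (lab_cover H (erng e)) => E; [exists ord0|exists ord_max]; rewrite -E.
split.
  have [i] := out ord0; rewrite (incidence_lab H) addn_gt0.
  by case: (ord2P i) => ->; rewrite mxE/= => ->; rewrite ?orbT.
have [i] := out ord_max; rewrite (incidence_lab H) addn_gt0.
by case: (ord2P i) => ->; rewrite mxE/= => ->; rewrite ?orbT.
Qed.

(** The second part says that the entry is at least [|a_n - d_n|].  If this is 0,
    positivity comes from the edges that leave each vertex: they prevent a column
    of [F_n] from being 0. *)
Lemma main_incidence i n :
  (0 < incidence (main_vertex i n.+2) (main_vertex i n.+1))%N /\
  (maxn (a n.+1) (d n.+1) <=
   incidence (main_vertex i n.+2) (main_vertex i n.+1) + minn (a n.+1) (d n.+1))%N.
Proof.
have [col0 col1] := column_gt0 n; have [ac db] := row_sums H n.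
have r0' : rev_ord ord0 = ord_max :> 'I_2 by exact: val_inj.
have r1' : rev_ord ord_max = ord0 :> 'I_2 by exact: val_inj.
rewrite /main_vertex /main_label -/(main_label i n).
by case: (ord2P (main_label i n)) => ->; case: (leqP (d n.+1) (a n.+1)) => da;
  rewrite ?r0' ?r1' (incidence_lab H) mxE/=; split=> //; lia.
Qed.

Lemma main_odometer i : odometer (main_vertex i).
Proof.
case=> [|n]; last by have [] := main_incidence i n.
have [_ -> _ _] := H; exact: (row_sum_gt0 total 0).
Qed.

Lemma main_share_ge i n : 1 - share R rtot (main_vertex i) n.+1 <=
  1 - `|(a n.+1)%:R - (d n.+1)%:R| / (r n.+1)%:R.
Proof.
rewrite lerD2l lerN2 ler_wpM2r ?invr_ge0//.
have [_] := main_incidence i n; rewrite -(ler_nat R) natrD.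
have [ad|da] := leqP (a n.+1) (d n.+1).
  by rewrite ler0_norm ?subr_le0 ?ler_nat//; lra.
by rewrite ger0_norm ?subr_ge0 ?ler_nat 1?ltnW//; lra.
Qed.

Lemma main_tail_products i : (sum_diff R a d r < +oo)%E ->
  tail_products_to_one (share R rtot (main_vertex i)).
Proof.
move=> fin; apply: summable_defect_tail_products; first exact: (share01 R total).
apply: le_lt_trans fin; apply: le_eseries_gt0 => -[//|k] _.
rewrite !lee_fin main_share_ge subr_ge0.
by have /andP[_ ->] := share01 R total (main_vertex i) k.+1.
Qed.

Lemma saturations_disjoint :
  odometer_saturation (main_vertex ord0) `&` odometer_saturation (main_vertex ord_max) = set0.
Proof.
rewrite !saturationE; try exact: main_odometer.
apply/seteqP; split=> // x [[m _ xm] [n _ xn]].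
have /eqP := main_vertex_neq (m + n); apply.
by apply: etrans (esym (xm _ _)) (xn _ _); lia.
Qed.

(** The two tail classes are invariant sets that together have mass 1. *)
Lemma ergodic_carried mu : (sum_diff R a d r < +oo)%E -> ergodic_invariant mu ->
  mu (odometer_saturation (main_vertex ord0)) = 1%E \/
  mu (odometer_saturation (main_vertex ord_max)) = 1%E.
Proof.
move=> fin [inv erg].
have full i : mu (odometer_saturation (main_vertex i)) = 0%E \/
    mu (odometer_saturation (main_vertex i)) = 1%E.
  have msat := measurable_saturation (main_odometer i).
  have [|->|] := erg _ msat; [exact: saturation_tail|by left|].
  rewrite probability_setC// => sat1; right; apply/eqP.
  rewrite eq_le probability_le1//=.
  by rewrite -sube_le0 sat1.
have := carried_cover total (main_odometer ord0) (main_odometer ord_max)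
  main_vertex_cover (main_tail_products _ fin) (main_tail_products _ fin) inv.
case: (full ord0) => [->|->]; last by left.
by case: (full ord_max) => [->|->]; [rewrite adde0 lee_fin ler10|right].
Qed.

Lemma two_ergodic_of_finite : (sum_diff R a d r < +oo)%E -> exactly_two_ergodic B R.
Proof.
move=> fin.
have [mu inv_mu mu1] := carried_exists total (main_odometer ord0) (main_tail_products _ fin).
have [nu inv_nu nu1] := carried_exists total (main_odometer ord_max) (main_tail_products _ fin).
have odo := main_odometer.
exists mu, nu; split.
- by split=> //; exact: (carried_ergodic H (odo ord0)).
- by split=> //; exact: (carried_ergodic H (odo ord_max)).
- have m0 := measurable_saturation (odo ord0).
  have m1 := measurable_saturation (odo ord_max).
  move=> same; have nu0 : nu (odometer_saturation (main_vertex ord0)) = 1%E.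
    by rewrite -[LHS](same _ m0).
  have : (nu (odometer_saturation (main_vertex ord0) `|`
      odometer_saturation (main_vertex ord_max)) <= 1)%E.
    by apply: probability_le1; exact: measurableU.
  rewrite measureU//; last exact: saturations_disjoint.
  rewrite [X in (X + _ <= _)%E]nu0 [X in (_ + X <= _)%E]nu1 -EFinD lee_fin.
  lra.
- move=> rho erg; have [inv _] := erg.
  have [rho1|rho1] := ergodic_carried fin erg; [left|right].
    exact: (same_measure_of_carried H (odo ord0)).
  exact: (same_measure_of_carried H (odo ord_max)).
Qed.

Lemma unique_of_divergent : sum_diff R a d r = +oo%E ->
  exists mu : probability (borel_path B) R, unique_invariant mu.
Proof.
move=> div; have [mu inv _] := limit_invariant R total (main_vertex ord0).
exists mu; split=> // nu inv'; exact: (same_measure_of_divergent H).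
Qed.

Lemma exactly_two_ergodicP : exactly_two_ergodic B R <-> (sum_diff R a d r < +oo)%E.
Proof.
split=> [[mu [nu [[imu _] [inu _] diff _]]]|]; last exact: two_ergodic_of_finite.
apply: contrapT => /sum_diff_infinite div; apply: diff.
exact: (same_measure_of_divergent H).
Qed.

Lemma unique_invariantP : (exists mu : probability (borel_path B) R, unique_invariant mu) <->
  sum_diff R a d r = +oo%E.
Proof.
split=> [[mu [_ uniq]]|]; last exact: unique_of_divergent.
apply/sum_diff_infinite => /two_ergodic_of_finite [nu [rho [[inu _] [irho _] diff _]]].
by apply: diff => A mA; rewrite (uniq _ inu)// (uniq _ irho).
Qed.

Lemma ergodic_extends mu : (sum_diff R a d r < +oo)%E -> ergodic_invariant mu ->
  exists2 w, odometer w & extends_from_odometer w mu.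
Proof.
move=> fin erg; have [inv _] := erg.
have [mu1|mu1] := ergodic_carried fin erg.
  exists (main_vertex ord0); first exact: main_odometer.
  exact: (full_saturation_extends total (main_odometer ord0)).
exists (main_vertex ord_max); first exact: main_odometer.
exact: (full_saturation_extends total (main_odometer ord_max)).
Qed.

(** Each entry is [a] or [d], hence at most [max a d], or [r - a] or [r - d],
    hence at most [r - min a d]. *)
Lemma min_min_le_defect w n :
  0 <= Num.min ((minn (a n.+1) (d n.+1))%:R / (r n.+1)%:R)
         (1 - (maxn (a n.+1) (d n.+1))%:R / (r n.+1)%:R : R)
    <= 1 - share R rtot w n.+1.
Proof.
rewrite le_min min_term_ge0 max_term_ge0 ge_min /share /rtot /row_total/=.
have rn := rpos n; have [ac db] := row_sums H n.
have sub1 f : 1 - f%:R / (r n.+1)%:R = ((r n.+1)%:R - f%:R) / (r n.+1)%:R :> R.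
  by rewrite mulrBl divff// gt_eqF.
rewrite !sub1 !ler_pM2r ?invr_gt0//.
have cases f : (f <= maxn (a n.+1) (d n.+1))%N \/ (f + minn (a n.+1) (d n.+1) <= r n.+1)%N ->
    ((minn (a n.+1) (d n.+1))%:R <= (r n.+1)%:R - f%:R :> R) ||
    ((r n.+1)%:R - (maxn (a n.+1) (d n.+1))%:R <= (r n.+1)%:R - f%:R :> R).
  case=> h; apply/orP; [right|left].
    by rewrite lerD2l lerN2 ler_nat.
  by rewrite lerBrDr -natrD ler_nat addnC.
apply: cases; case: (lab_cover H (w n.+2)) => ->; case: (lab_cover H (w n.+1)) => ->;
  rewrite (incidence_lab H) mxE/=; lia.
Qed.

Lemma not_extends_of_min_min mu w : sum_min_min R a d r = +oo%E ->
  invariant mu -> odometer w -> ~ extends_from_odometer w mu.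
Proof.
move=> div inv odo ext.
have := extends_summable_defect total inv ext.
suff : (sum_min_min R a d r <= \sum_(1 <= k <oo) (1 - share R rtot w k)%:E)%E.
  by rewrite div leye_eq => /eqP ->; rewrite ltxx.
by apply: le_eseries_gt0 => -[//|k] _; rewrite !lee_fin min_min_le_defect.
Qed.

End classification.

(** * Path spaces that are Cantor sets *)

Section cantor.
Variable B : bratteli.

(** An ultrafilter selects one edge at each level; these edges form a path, which is
    its limit. *)
Lemma compact_paths : compact [set: path_space B].
Proof.
rewrite compact_ultra => F FU _; have FF : ProperFilter F by exact: ultra_proper.
have cell n : exists e : edge B n, F [set x | pedge x n = e].
  apply: contrapT => H.
  have : \forall x \near F, forall e : edge B n, pedge x n <> e.
    apply: filter_forall => e.
    have [Fe|//] := in_ultra_setVsetC [set x | pedge x n = e] FU.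
    by exfalso; apply: H; exists e.
  by move=> /filter_ex [x /(_ (pedge x n))].
pose f n := projT1 (cid (cell n)).
have fP n : F [set x | pedge x n = f n] := projT2 (cid (cell n)).
have [|x xf] := @path_of_edges B f.
  move=> n; have [x [x0 x1]] := filter_ex (filterI (fP n) (fP n.+1)).
  by rewrite -x0 -x1 erng_pedge.
have Fx n : F (cylinder x n).
  elim: n => [|n IH]; first by rewrite cylinder0; exact: filterT.
  by rewrite cylinderS; apply: filterI => //; rewrite xf.
exists x; split=> // U /nbhs_cylinder [n nU]; exact: filterS nU (Fx n).
Qed.

Lemma cylinder_clopen (x : path_space B) n : clopen (cylinder x n).
Proof.
split; first exact: cylinder_open.
rewrite -[X in closed X]setCK; apply: open_closedC.
rewrite openE => y xy; apply: (@filterS _ _ _ (cylinder y n)).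
  by move=> z yz xz; apply: xy; apply: cylinder_trans xz _; exact: cylinder_sym.
by apply: open_nbhs_nbhs; split; [exact: cylinder_open|].
Qed.

Lemma zero_dimensional_paths : zero_dimensional (path_space B).
Proof.
move=> x y /eqP xy.
have [n xn] : exists n, pedge x n <> pedge y n.
  by apply/existsNP => E; apply: xy; apply: path_ext.
exists (cylinder x n.+1); split=> //; first exact: cylinder_clopen.
by move=> /(_ n (ltnSn n)) /esym.
Qed.

Lemma hausdorff_paths : hausdorff_space (path_space B).
Proof.
rewrite open_hausdorff => x y /zero_dimensional_paths [U [[oU cU] Ux Uy]].
exists (U, ~` U); rewrite ?inE//; split=> //=; first exact: closed_openC.
by rewrite setICr.
Qed.

(** If the singleton of [x] is open it contains a cylinder around [x], hence also paths that
    continue the prefix of [x] by two different edges. *)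
Lemma perfect_paths :
  (forall n (v : vertex B n), exists e f : edge B n,
     [/\ e != f, esrc e = v & esrc f = v]) ->
  perfect_set [set: path_space B].
Proof.
move=> branch; apply/perfectTP => x ox.
have [n nx] := nbhs_cylinder (open_nbhs_nbhs (conj ox (erefl x))).
have [e [f [ef ev fv]]] := branch n (pvertex x n).
have [y xy ye] := extend_path ev; have [z xz zf] := extend_path fv.
by move: ef; rewrite -ye -zf (nx _ xy) (nx _ xz) eqxx.
Qed.

End cantor.

Lemma cantor_like_is_cantor_set (R : realType) (T : pseudoPMetricType R) :
  cantor_like T -> is_cantor_set T.
Proof.
move=> like; have [f [fc fcl]] := homeomorphism_cantor_like like.
exists (f^-1)%FUN, f; split.
- apply/continuous_closedP => A cA.
  suff -> : (f^-1)%FUN @^-1` A = f @` A by exact: fcl.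
  apply/seteqP; split=> [x Ax|_ [x Ax <-]]; last by rewrite /= funK ?inE.
  by exists (f^-1%FUN x) => //; rewrite invK ?inE.
- exact: fc.
- by move=> x; rewrite invK ?inE.
- by move=> x; rewrite funK ?inE.
Qed.

(** The equation allows the topology of [Y] to be given otherwise than through
    the pseudometric that the classification of Cantor sets requires. *)
Lemma cantor_like_subset (R : realType) (X : pseudoMetricType R)
    (Y : topologicalType) (A : set Y) : (X : topologicalType) = Y ->
  cantor_like (set_type A) -> A !=set0 -> is_cantor_set (set_type A).
Proof.
move=> XY; case: _ / XY A => A like [x Ax].
pose T0 : pseudoMetricType R := set_type A.
pose T : pseudoPMetricType R := HB.pack (PseudoMetric.sort T0) T0
  (isPointed.Build (PseudoMetric.sort T0) (SigSub (mem_set Ax) : set_type A)).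
exact: (@cantor_like_is_cantor_set R T like).
Qed.

Lemma cantor_paths (R : realType) (B : bratteli) :
  (forall n (v : vertex B n), exists e f : edge B n,
     [/\ e != f, esrc e = v & esrc f = v]) ->
  is_cantor_set (path_space B).
Proof.
move=> branch.
pose X : pseudoMetricType R := prod_topology (fun n => discrete_topology (edge B n)).
apply: (@cantor_like_subset R X _ (path_set B)).
- by [].
- split; [exact: (perfect_paths branch)|exact: (@compact_paths B)|
    exact: (@hausdorff_paths B)|exact: (@zero_dimensional_paths B)].
- by exists (set_val (point : path_space B)); exact: set_valP.
Qed.

(** * Two diagrams with a unique invariant measure *)

(** In the diagrams below the vertex [t n] of level [n.+1] is the source of all edges
    into the vertex [t n] of level [n.+2], while the other vertex of level [n.+2]
    receives one edge from it and two from the other vertex. *)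
Section absorbing.
Variable t : nat -> 'I_2.

Definition absorbing_vertex n : finType := if n is 0 then unit else 'I_2.

Definition absorbing_edge n : finType := if n is 0 then 'I_2 else ('I_2 * 'I_3)%type.

Definition absorbing_src n : absorbing_edge n -> absorbing_vertex n :=
  match n with
  | 0 => fun=> tt
  | m.+1 => fun e => if (e.1 == t m) || (e.2 == ord0) then t m else e.1
  end.

Definition absorbing_rng n : absorbing_edge n -> absorbing_vertex n.+1 :=
  match n with 0 => id | m.+1 => fst end.

Lemma absorbing_root : #|absorbing_vertex 0| = 1%N.
Proof. exact: card_unit. Qed.

Lemma absorbing_src_surj n v : exists e, @absorbing_src n e = v.
Proof.
case: n v => [[]|n v]; first by exists ord0.
by exists (v, ord_max) => /=; case: eqP.
Qed.

Lemma absorbing_rng_surj n v : exists e, @absorbing_rng n e = v.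
Proof. by case: n v => [|n] v; [exists v | exists (v, ord0)]. Qed.

Definition absorbing_diagram :=
  Bratteli absorbing_root absorbing_src_surj absorbing_rng_surj.

Definition absorbing_lab n : 'I_2 -> vertex absorbing_diagram n.+1 := id.

Lemma absorbing_incidence n (i j : 'I_2) :
  @incidence absorbing_diagram n.+1 i j =
  if i == t n then (if j == t n then 3 else 0)
  else if j == t n then 1 else 2.
Proof.
rewrite /incidence -sum1_card big_mkcond /=.
rewrite -(pair_bigA _ (fun x k => if (x, k) \in [pred e : absorbing_edge n.+1 |
  (@absorbing_src n.+1 e == j) && (@absorbing_rng n.+1 e == i)] then 1 else 0))%N /=.
rewrite !big_ord_recl !big_ord0 !inE /=.
by case: (ord2P (t n)) => ->; case: (ord2P i) => ->; case: (ord2P j) => ->.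
Qed.

(** The matrix [F_n] describes the edges into level [n.+1], which are those governed by
    [t n.-1]. *)
Definition by_label n (x y : nat) := if t n.-1 == ord0 then x else y.

Lemma absorbing_two_by_two : two_by_two_equal_row_sum absorbing_lab 1
  (fun n => by_label n 3 2) (fun n => by_label n 2 3) (fun n => by_label n 0 1)
  (fun n => by_label n 1 0) (fun=> 3).
Proof.
split.
- by move=> n; exists id.
- move=> v [] /=; rewrite /incidence.
  transitivity #|pred1 (v : edge absorbing_diagram 0)|; last exact: card1.
  by apply: eq_card => e; rewrite !inE.
- move=> n; apply/matrixP => i j; rewrite !mxE absorbing_incidence /by_label /=.
  by case: (ord2P (t n)) => ->; case: (ord2P i) => ->; case: (ord2P j) => ->.
- by move=> n; rewrite /by_label; case: ifP.
Qed.

Lemma absorbing_branching n (v : vertex absorbing_diagram n) :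
  exists e f : edge absorbing_diagram n, [/\ e != f, esrc e = v & esrc f = v].
Proof.
case: n v => [[]|n v]; first by exists ord0, ord_max.
have [->|vt] := eqVneq v (t n).
  by exists (ord0, ord0), (ord_max, ord0); rewrite /= !orbT.
exists (v, ord_max), (v, lift ord0 ord0).
by rewrite /= !(negbTE vt) xpair_eqE eqxx.
Qed.

Section sums.
Local Open Scope ring_scope.
Variable R : realType.

Lemma third_series_infinite (f : nat -> R) :
  (forall k, (0 < k)%N -> 1 / 3 <= f k + f k.+1) -> (forall k, 0 <= f k) ->
  (\sum_(1 <= k <oo) (f k)%:E)%E = +oo%E.
Proof.
move=> f13 f0; apply/eqP; rewrite -leye_eq leNgt; apply/negP => fin.
have e0 : 0 < 1 / 4 :> R by lra.
have [n nP] := nneseries_small_tails f0 fin e0.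
have := nP n.+1 2%N (leqnSn n).
rewrite addn2 big_nat_recr// big_nat1/=; have := f13 n.+1 isT; lra.
Qed.

Lemma absorbing_sum_diff :
  sum_diff R (fun n => by_label n 3 2) (fun n => by_label n 1 0) (fun=> 3%N) = +oo%E.
Proof.
rewrite /sum_diff.
have E k : 1 - `|(by_label k 3 2)%:R - (by_label k 1 0)%:R| / 3%:R = 1 / 3 :> R.
  by rewrite /by_label; case: ifP => _; rewrite ger0_norm; lra.
under eq_eseriesr do rewrite E.
by apply: third_series_infinite => *; lra.
Qed.

Lemma absorbing_sum_min_min :
  sum_min_min R (fun n => by_label n 3 2) (fun n => by_label n 1 0) (fun=> 3%N) = 0%E.
Proof.
rewrite /sum_min_min; apply: eseries0 => k _ _; congr EFin.
rewrite /by_label; case: ifP => _; rewrite /maxn /minn /=.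
  by rewrite divff ?subrr// min_r// divr_ge0.
by rewrite mul0r min_l//; lra.
Qed.

End sums.
End absorbing.

Section examples.
Local Open Scope ring_scope.
Variable R : realType.

(** Always the same absorbing vertex: all of its incoming edges come from the
    absorbing vertex below, so that the odometer through them has full mass. *)
Lemma unique_from_odometer : exists (B : bratteli)
    (lab : forall n, 'I_2 -> vertex B n.+1) (r0 : nat) (a b c d r : nat -> nat),
  [/\ two_by_two_equal_row_sum lab r0 a b c d r, is_cantor_set (path_space B),
      sum_diff R a d r = +oo%E, sum_min_min R a d r <> +oo%E
    & exists2 mu : probability (borel_path B) R, unique_invariant mu &
        exists2 w, odometer w & extends_from_odometer w mu].
Proof.
pose t (n : nat) : 'I_2 := ord0.
pose B := absorbing_diagram t.
have H := absorbing_two_by_two t.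
exists B, (@absorbing_lab t); do 6!eexists; split; first exact: H.
- exact: (cantor_paths R (@absorbing_branching t)).
- exact: absorbing_sum_diff.
- by rewrite absorbing_sum_min_min.
pose w n : vertex B n :=
  match n return absorbing_vertex n with 0 => tt | _ => ord0 end.
have inc n : incidence (w n.+2) (w n.+1) = 3%N by rewrite absorbing_incidence.
have odo : odometer w.
  by case=> [|n]; [have [_ -> _ _] := H|rewrite inc].
have share1 n : share R (row_total 1 (fun=> 3%N)) w n.+1 = 1.
  by rewrite /share inc /= divff.
have tails : tail_products_to_one (share R (row_total 1 (fun=> 3%N)) w).
  move=> e e0; exists 1%N => m k m1; rewrite big_nat big1 ?gerBl ?ltW// => -[|j] /andP[mj _] //.
  by move: (leq_trans m1 mj).
have [mu inv mu1] := carried_exists (rowsum H) odo tails.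
exists mu; last by exists w => //; exact: (full_saturation_extends (rowsum H) odo).
split=> // nu inv'; apply: (same_measure_of_divergent H) => //.
exact: absorbing_sum_diff.
Qed.

(** The absorbing vertex alternates, so that of two consecutive edge sets an
    odometer uses at most two thirds in one of them. *)
Lemma unique_not_from_odometer : exists (B : bratteli)
    (lab : forall n, 'I_2 -> vertex B n.+1) (r0 : nat) (a b c d r : nat -> nat),
  [/\ two_by_two_equal_row_sum lab r0 a b c d r, is_cantor_set (path_space B),
      sum_diff R a d r = +oo%E, sum_min_min R a d r <> +oo%E
    & exists2 mu : probability (borel_path B) R, unique_invariant mu &
        ~ exists2 w, odometer w & extends_from_odometer w mu].
Proof.
pose t (n : nat) : 'I_2 := if odd n then ord_max else ord0.
pose B := absorbing_diagram t.
have H := absorbing_two_by_two t.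
exists B, (@absorbing_lab t); do 6!eexists; split; first exact: H.
- exact: (cantor_paths R (@absorbing_branching t)).
- exact: absorbing_sum_diff.
- by rewrite absorbing_sum_min_min.
have [mu uniq] := unique_of_divergent H (absorbing_sum_diff t R).
exists mu => // -[w odo ext]; have [inv _] := uniq.
have := extends_summable_defect (rowsum H) inv ext.
rewrite third_series_infinite ?ltxx//; last first.
  by move=> k; rewrite subr_ge0; case/andP: (share01 R (rowsum H) w k).
case=> // k _; rewrite /share /= !absorbing_incidence.
have -> : t k.+1 = rev_ord (t k) by rewrite /t /=; case: odd; exact: val_inj.
by case: (ord2P (t k)) => ->; case: (ord2P (w k.+1)) => ->;
  case: (ord2P (w k.+2)) => ->; case: (ord2P (w k.+3)) => -> /=; lra.
Qed.

End examples.

(** * The dichotomy *)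

Theorem proposition3p1 (R : realType) :
  (forall (B : bratteli) (lab : forall n, 'I_2 -> vertex B n.+1) (r0 : nat)
          (a b c d r : nat -> nat),
     two_by_two_equal_row_sum lab r0 a b c d r ->
     is_cantor_set (path_space B) ->
     [/\ exactly_two_ergodic B R <-> (sum_diff R a d r < +oo)%E,
         (sum_diff R a d r < +oo)%E <->
           (sum_max R a d r < +oo)%E /\ (sum_min R a d r < +oo)%E,
         (sum_diff R a d r < +oo)%E ->
           forall mu : probability (borel_path B) R, ergodic_invariant mu ->
           exists2 w, odometer w & extends_from_odometer w mu,
         (exists mu : probability (borel_path B) R, unique_invariant mu) <->
           sum_diff R a d r = +oo%E
       & sum_min_min R a d r = +oo%E ->
           forall mu : probability (borel_path B) R, unique_invariant mu ->
           ~ exists2 w, odometer w & extends_from_odometer w mu]) /\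
  (exists (B : bratteli) (lab : forall n, 'I_2 -> vertex B n.+1) (r0 : nat)
          (a b c d r : nat -> nat),
     [/\ two_by_two_equal_row_sum lab r0 a b c d r,
         is_cantor_set (path_space B),
         sum_diff R a d r = +oo%E,
         sum_min_min R a d r <> +oo%E
       & exists2 mu : probability (borel_path B) R, unique_invariant mu &
           exists2 w, odometer w & extends_from_odometer w mu]) /\
  (exists (B : bratteli) (lab : forall n, 'I_2 -> vertex B n.+1) (r0 : nat)
          (a b c d r : nat -> nat),
     [/\ two_by_two_equal_row_sum lab r0 a b c d r,
         is_cantor_set (path_space B),
         sum_diff R a d r = +oo%E,
         sum_min_min R a d r <> +oo%E
       & exists2 mu : probability (borel_path B) R, unique_invariant mu &
           ~ exists2 w, odometer w & extends_from_odometer w mu]).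
Proof.
split; last by split; [exact: unique_from_odometer|exact: unique_not_from_odometer].
move=> B lab r0 a b c d r H _; split.
- exact: exactly_two_ergodicP H.
- exact: sum_diff_max_min H.
- by move=> fin mu; exact: ergodic_extends H _ fin.
- exact: unique_invariantP H.
- move=> div mu [inv _] [w odo]; exact: (not_extends_of_min_min H div inv odo).
Qed.
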